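(* Let $\mathbb{S}=\mathbb{R}/2\pi\mathbb{Z}$ and for a positive integer $q$ and $t\in\mathbb{S}$ let $$U_q(t)=\bigl(\cos t,\ \sin t,\ \cos 3t,\ \sin 3t,\ \ldots,\ \cos(2q-1)t,\ \sin(2q-1)t\bigr)\in\mathbb{R}^{2q}.$$ Fix positive integers $k,m,n,r$ with $n$ even. Let $\Psi_{k,m}(t)=\bigl(U_{3k}(t),U_{3k}(5t),\ldots,U_{3k}(5^mt)\bigr)\in\mathbb{R}^{6k(m+1)}$, let $A_{m,n}=\{2\pi j/(n5^m):\ j=0,\ldots,n5^m-1\}\subset\mathbb{S}$, and let $P=\operatorname{conv}\bigl(\Psi_{k,m}(t):\ t\in A_{m,n}\bigr)\subset\mathbb{R}^{6k(m+1)}$ (a centrally symmetric polytope with $n5^m$ vertices). For $d=6kr(m+1)$, identify $\mathbb{R}^d$ with the direct sum of $r$ copies of $\mathbb{R}^{6k(m+1)}$, each containing a copy of $P$, and let $Q\subset\mathbb{R}^d$ be the convex hull of the union of these $r$ copies of $P$ (so $Q$ is a centrally symmetric polytope with $rn5^m$ vertices). If $$r<\min\left\{(k+1)!,\ \left(\frac{5^{k-1}}{5^{k-1}-1}\right)^m\right\},$$ then the probability that $r$ vertices of $Q$, chosen independently at random from the uniform distribution on the set of vertices of $Q$, span a face of $Q$ (i.e. their convex hull is a face of $Q$) is at least $$\left(1-\frac{r}{(k+1)!}\right)\left(1-r\left(1-5^{-k+1}\right)^m\right).$$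
   Context: A polytope is the convex hull of finitely many points in $\mathbb{R}^d$. A face of a convex body is its intersection with a supporting affine hyperplane. *)

(* Defs.v *)
From HB Require Import structures.
From mathcomp Require Import all_boot all_order all_algebra.
From mathcomp Require Import all_classical all_reals all_analysis.
Unset Printing Implicit Defensive.
Import Order.TTheory GRing.Theory Num.Theory.
Local Open Scope classical_set_scope.
Local Open Scope ring_scope.

Section Defs.
Variable R : realType.

Definition Ucoord (t : R) (i : nat) : R :=
  let j := i./2 in
  if odd i then sin ((2 * j + 1)%N%:R * t) else cos ((2 * j + 1)%N%:R * t).

Definition U (q : nat) (t : R) : 'rV[R]_(2 * q) := \row_(i < 2 * q) Ucoord t i.

Definition Psicoord (k : nat) (t : R) (i : nat) : R :=
  Ucoord ((5 ^ (i %/ (6 * k)))%N%:R * t) (i %% (6 * k)).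

Definition Psi (k m : nat) (t : R) : 'rV[R]_(6 * k * m.+1) :=
  \row_(i < 6 * k * m.+1) Psicoord k t i.

Definition Aset (m n : nat) : set R :=
  [set t | exists j : nat, (j < n * 5 ^ m)%N /\ t = 2 * pi * j%:R / (n * 5 ^ m)%N%:R].

Definition dotv (d : nat) (a x : 'rV[R]_d) : R := \sum_(i < d) a 0 i * x 0 i.

Definition conv (d : nat) (S : set 'rV[R]_d) : set 'rV[R]_d :=
  [set x | exists (N : nat) (p : 'I_N -> 'rV[R]_d) (w : 'I_N -> R),
      (forall i, S (p i)) /\ (forall i, 0 <= w i) /\ \sum_(i < N) w i = 1 /\
      x = \sum_(i < N) w i *: p i].

Definition is_face (d : nat) (K F : set 'rV[R]_d) : Prop :=
  exists (a : 'rV[R]_d) (b : R),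
    a != 0 /\ (forall x, K x -> dotv d a x <= b) /\
    (exists x, K x /\ dotv d a x = b) /\
    F = K `&` [set x | dotv d a x = b].

Definition vertices (d : nat) (K : set 'rV[R]_d) : set 'rV[R]_d :=
  [set v | is_face d K [set v]].

Definition Ppoly (k m n : nat) : set 'rV[R]_(6 * k * m.+1) :=
  conv (6 * k * m.+1) (Psi k m @` Aset m n).

(* the c-th summand embedding R^D -> R^(D*r), D = 6k(m+1):
   coordinates c*D .. c*D + D - 1 *)
Definition embed (D r : nat) (c : nat) (x : 'rV[R]_D) : 'rV[R]_(D * r) :=
  \row_(i < D * r) (if (i %/ D == c)%N then
        (if (i %% D < D)%N =P true is ReflectT h then x 0 (Ordinal h) else 0)
      else 0).

Definition Qpoly (k m n r : nat) : set 'rV[R]_(6 * k * m.+1 * r) :=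
  conv (6 * k * m.+1 * r) (\bigcup_(c in [set c : nat | (c < r)%N]) (embed (6 * k * m.+1) r c @` Ppoly k m n)).

(* Probability that r vertices drawn independently and uniformly from the
   (finite) vertex set, enumerated without repetition by vs, span a face *)
Definition face_prob (d : nat) (K : set 'rV[R]_d) (vs : seq 'rV[R]_d) (r : nat) : R :=
  (#|[set f : {ffun 'I_r -> 'I_(size vs)} |
       `[< is_face d K (conv d [set nth 0 vs (f i) | i in [set: 'I_r]]) >] ]|)%:R
  / ((size vs) ^ r)%N%:R.

End Defs.

(* Main.v *)
(* Distribute the r random vertices over the r copies of P: with probability at least
   1 - r/(k+1)! no copy receives more than k of them.  Given this, write the index
   j of t = 2 pi j / (n 5^m) with m base-5 digits; in a given copy the chosen
   indices share some digit except with probability at most (1 - 5^(1-k))^m.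

   If the l-th digits agree, then for i = m - 1 - l the points 5^i t lie in an arc
   of length 2 pi / 5 with midpoint z.  There some odd trigonometric polynomial f of
   degree at most 6k - 1 attains its maximum 1 on the circle exactly at these points
   and their reflections in z: interpolate 1 / cos by a polynomial in sin^2, which
   gives an odd polynomial H in cos with H = 1 at the nodes, and H > -2 by the error
   formula; then f = (3 H - H^3) / 2 works since 1 - f = (H - 1)^2 (H + 2) / 2.
   The unwanted maximum points, first the reflections and then, going down through
   the levels i, i - 1, ..., 0, the other preimages under t -> 5 t, are removed by
   passing to faces of faces: at each step at most 6k points are involved, no two of
   them antipodal, so an odd trigonometric polynomial of degree at most 6k - 1 can
   take the values 1 and 0 on them as prescribed.

   Finally, functionals with maximum 1 on the copies of P combine into one on Q. *)
Require Import Defs.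
From HB Require Import structures.
From mathcomp Require Import all_boot all_order all_algebra.
From mathcomp Require Import all_classical all_reals all_analysis.
From mathcomp Require Import ring lra zify.
Import Order.TTheory GRing.Theory Num.Theory.
Import numFieldNormedType.Exports.
Set Implicit Arguments.
Unset Strict Implicit.
Local Open Scope ring_scope.

(** * Counting *)

Section Counting.
Local Open Scope nat_scope.

(* For l < m, digit n l j tells which of the arcs [2 pi d/5, 2 pi (d+1)/5) contains
   5^(m-1-l) t, where t = 2 pi j / (n 5^m). *)
Definition digit (n l j : nat) : nat := (j %/ (n * 5 ^ l)) %% 5.

(** The quotient [j %/ n] is below 5^m, hence determined by its m base-5 digits; the induction peels
    off the lowest one. *)
Lemma digit_inj n m j j' : 0 < n -> j < n * 5 ^ m -> j' < n * 5 ^ m -> j %% n = j' %% n ->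
  (forall l, l < m -> digit n l j = digit n l j') -> j = j'.
Proof.
move=> n0 jN j'N jn dj; rewrite (divn_eq j n) (divn_eq j' n) jn; congr (_ * _ + _).
have {jN} : j %/ n < 5 ^ m by rewrite ltn_divLR // mulnC.
have {j'N} : j' %/ n < 5 ^ m by rewrite ltn_divLR // mulnC.
have {dj} : forall l, l < m -> (j %/ n %/ 5 ^ l) %% 5 = (j' %/ n %/ 5 ^ l) %% 5.
  by move=> l lm; rewrite -!divnMA; exact: dj.
elim: m (j %/ n) (j' %/ n) => [|m IH] e e' de.
  by rewrite expn0 !ltnS !leqn0 => /eqP -> /eqP ->.
move=> he' he; rewrite (divn_eq e 5) (divn_eq e' 5); congr (_ * _ + _).
  apply: IH => [l lm||]; last 2 first.
  - by rewrite ltn_divLR // -expnSr.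
  - by rewrite ltn_divLR // -expnSr.
  by rewrite -!divnMA -expnS; exact: de.
by have := de 0 isT; rewrite expn0 !divn1.
Qed.

Lemma card_bigcup_le (I T : finType) (P : pred I) (F : I -> {set T}) :
  #|\bigcup_(i | P i) F i| <= \sum_(i | P i) #|F i|.
Proof.
elim/big_rec2: _ => [|i B s _ IH]; first by rewrite cards0.
by rewrite (leq_trans (leq_card_setU _ _).1) // leq_add2l.
Qed.

Section Functions.
Variables (I T : finType).
Implicit Types (S : {set I}) (h : {ffun I -> T}).

Lemma card_ffun_eq_on S (d : T) :
  #|[set h : {ffun I -> T} | [forall i in S, h i == d]]| = #|T| ^ #|~: S|.
Proof.
rewrite -(card_pffun_on d [in ~: S] (mem T)); apply: eq_card => h; rewrite inE.
apply/forall_inP/pffun_onP => [hS|[hS _] i iS].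
  split=> //; apply/fintype.subsetP => i; rewrite !inE => hd.
  by apply: contra hd => /hS.
apply/negPn/negP => hd; move/fintype.subsetP: hS => /(_ i hd).
by rewrite !inE iS.
Qed.

Definition const_on S h := [forall i in S, forall i' in S, h i == h i'].

(** Sum over the common value d, read at a chosen point of S; outside S the values are free. *)
Lemma card_const_on S : 0 < #|S| ->
  #|[set h : {ffun I -> T} | const_on S h]| = #|T| * #|T| ^ #|~: S|.
Proof.
move=> /card_gt0P[i0 i0S]; rewrite -sum1_card.
rewrite (partition_big (fun h : {ffun I -> T} => h i0) xpredT) //=.
rewrite -[RHS]sum_nat_const; apply: eq_bigr => d _.
rewrite sum1_card -(card_ffun_eq_on S d); apply: eq_card => h; rewrite [LHS]unfold_in !inE.
rewrite /const_on; apply/andP/forall_inP => [[/forall_inP hS /eqP <-] i iS|hS].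
  by have /forall_inP/(_ i0 i0S) := hS i iS.
split; last exact: hS.
apply/forall_inP => i iS; apply/forall_inP => i' i'S.
by rewrite (eqP (hS i iS)) (eqP (hS i' i'S)).
Qed.

End Functions.

(** * Occupancy: how many draws fall into one copy *)

Section Occupancy.
Variables (k r : nat).

Definition fiber (al : {ffun 'I_r -> 'I_r}) (c : 'I_r) : {set 'I_r} := [set i | al i == c].

(** Union bound over pairs of a cell c and a set of k+1 draws that all land in c: the count is at
    most r C(r,k+1) r^(r-k-1), and C(r,k+1) (k+1)! is a falling factorial, at most r^(k+1). *)
Lemma card_crowded : 0 < r ->
  #|[set al : {ffun 'I_r -> 'I_r} | [exists c, k < #|fiber al c|]]| * (k.+1)`! <= r * r ^ r.
Proof.
move=> r0.
pose F (p : 'I_r * {set 'I_r}) := [set al : {ffun 'I_r -> 'I_r} | [forall i in p.2, al i == p.1]].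
pose P (p : 'I_r * {set 'I_r}) := #|p.2| == k.+1.
have sub : [set al : {ffun 'I_r -> 'I_r} | [exists c, k < #|fiber al c|]] \subset
    \bigcup_(p | P p) F p.
  apply/fintype.subsetP => al; rewrite inE => /existsP[c ck].
  pose s := take k.+1 (enum (fiber al c)).
  have us : uniq s by rewrite take_uniq // enum_uniq.
  apply/bigcupP; exists (c, [set i in s]).
    by rewrite /P /= cardsE (card_uniqP us) size_takel // -cardE.
  rewrite inE; apply/forall_inP => i /=; rewrite inE => /mem_take.
  by rewrite mem_enum inE.
have sumE : \sum_(p | P p) #|F p| = r * 'C(r, k.+1) * r ^ (r - k.+1).
  transitivity (\sum_(p | P p) r ^ (r - k.+1)).
    apply: eq_bigr => p /eqP pk; rewrite /F card_ffun_eq_on card_ord.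
    by rewrite cardsCs finset.setCK card_ord pk.
  rewrite sum_nat_const; congr (_ * _).
  have -> : #|P| = #|finset.setX (finset.setTfor 'I_r) [set S : {set 'I_r} | #|S| == k.+1]|.
    by apply: eq_card => -[c S]; rewrite [LHS]unfold_in finset.in_setX !inE.
  by rewrite cardsX cardsT card_draws card_ord.
apply: leq_trans (leq_mul (leq_trans (subset_leq_card sub) (card_bigcup_le _ _)) (leqnn _)) _.
rewrite sumE -!mulnA leq_mul2l; apply/orP; right.
have [rk|kr] := ltnP r k.+1; first by rewrite bin_small.
rewrite mulnA mulnAC bin_ffact.
have -> : r ^ r = r ^ k.+1 * r ^ (r - k.+1) by rewrite -expnD subnKC.
rewrite leq_mul2r; apply/orP; right.
rewrite ffact_prod -[X in _ <= r ^ X](card_ord k.+1) -prod_nat_const.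
by apply: leq_prod => i _; rewrite leq_subr.
Qed.

End Occupancy.

(** * Tuples of indices that share no digit on a given set of draws *)

Section Digits.
Variables (m n r : nat).
Hypothesis n0 : 0 < n.
Local Notation N := (n * 5 ^ m).

Definition level_const (S : {set 'I_r}) (be : {ffun 'I_r -> 'I_N}) (l : nat) :=
  [forall i in S, forall i' in S, digit n l (be i) == digit n l (be i')].

(** The map [phi] records residues modulo n and, for each level, the vector of digits. It is
    injective, and a tuple counted here has all m digit vectors among those that are not constant on
    S. *)
Lemma card_spread (S : {set 'I_r}) : 0 < #|S| ->
  #|[set be : {ffun 'I_r -> 'I_N} | [forall l : 'I_m, ~~ level_const S be l]]| <=
  n ^ r * (5 ^ r - 5 * 5 ^ (r - #|S|)) ^ m.
Proof.
move=> S0.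
pose C := [set h : {ffun 'I_r -> 'I_5} | const_on S h].
pose dig (l : 'I_m) (be : {ffun 'I_r -> 'I_N}) : {ffun 'I_r -> 'I_5} :=
  [ffun i => inord (digit n l (be i))].
pose phi (be : {ffun 'I_r -> 'I_N}) : {ffun 'I_r -> 'I_n} * {ffun 'I_m -> {ffun 'I_r -> 'I_5}} :=
  ([ffun i => Ordinal (ltn_pmod (be i) n0)], [ffun l => dig l be]).
have digE l be i : dig l be i = digit n l (be i) :> nat.
  by rewrite ffunE inordK // ltn_pmod.
have phi_inj : injective phi.
  move=> be be' [e1 e2]; apply/ffunP => i; apply/val_inj.
  apply: (@digit_inj n m) => //= [|l lm].
    by have /ffunP/(_ i) := e1; rewrite !ffunE => -[].
  have /ffunP/(_ (Ordinal lm)) := e2; rewrite !ffunE => /ffunP/(_ i) /(congr1 val) /=.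
  by rewrite !digE.
have Ccard : #|~: C| = 5 ^ r - 5 * 5 ^ (r - #|S|).
  rewrite cardsCs finset.setCK card_ffun !card_ord card_const_on // card_ord.
  by rewrite [#|~: S|]cardsCs finset.setCK card_ord.
have <- : #|finset.setX (finset.setTfor {ffun 'I_r -> 'I_n}) [set f : {ffun 'I_m -> {ffun 'I_r -> 'I_5}} | f \in ffun_on [in ~: C]]| =
    n ^ r * (5 ^ r - 5 * 5 ^ (r - #|S|)) ^ m.
  by rewrite cardsX cardsT card_ffun !card_ord cardsE card_ffun_on card_ord Ccard.
rewrite -(card_imset _ phi_inj); apply: subset_leq_card; apply/fintype.subsetP => _ /imsetP[be + ->].
rewrite !inE /= => /forallP hl; apply/ffun_onP => l; rewrite ffunE !inE.
apply: contra (hl l) => /forall_inP h.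
apply/forall_inP => i iS; apply/forall_inP => i' i'S.
by have /forall_inP/(_ i' i'S)/eqP := h i iS; rewrite -!digE => ->.
Qed.

End Digits.
End Counting.

(** * From counts to the probability bound *)

Section Probability.
Variables (R : realFieldType) (k m n r : nat).
Hypotheses (k0 : (0 < k)%N) (m0 : (0 < m)%N) (n0 : (0 < n)%N) (r0 : (0 < r)%N).
Local Notation N := (n * 5 ^ m)%N.
Local Notation q := ((1 - ((5%:R : R) ^+ k.-1)^-1) ^+ m).

(** Each level contributes the factor 5^r (1 - 5^(1-|S|)), at most 5^r (1 - 5^(1-k)) because |S| <=
    k. *)
Lemma card_spread_le (S : {set 'I_r}) : (#|S| <= k)%N ->
  (#|[set be : {ffun 'I_r -> 'I_N} | [forall l : 'I_m, ~~ level_const S be l]]|)%:R <=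
  N%:R ^+ r * q.
Proof.
move=> Sk; have q5 : 0 <= 1 - ((5%:R : R) ^+ k.-1)^-1.
  by rewrite subr_ge0 invf_le1 ?exprn_gt0 // exprn_ege1 // ler1n.
have [S0|S0] := posnP #|S|.
  (* On the empty set every level is constant, and [m0] supplies a level, so no tuple is counted. *)
  rewrite (_ : [set be | _] = finset.set0) ?cards0 ?mulr_ge0 ?exprn_ge0 ?ler0n //.
  apply/finset.setP => be; rewrite !inE; apply/negbTE; rewrite negb_forall.
  apply/existsP; exists (Ordinal m0); rewrite negbK; apply/forall_inP => i.
  by rewrite (cards0_eq S0) inE.
apply: le_trans (_ : (n ^ r * (5 ^ r - 5 * 5 ^ (r - #|S|)) ^ m)%N%:R <= _).
  by rewrite ler_nat card_spread.
have Sr : (#|S| <= r)%N by rewrite -[X in (_ <= X)%N]card_ord max_card.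
rewrite !natrM !natrX exprMn -mulrA ler_pM2l ?exprn_gt0 ?ltr0n //.
rewrite -exprM (mulnC m r) exprM -exprMn; apply: lerXn2r; rewrite ?nnegrE ?ler0n //.
  by rewrite mulr_ge0 ?exprn_ge0.
have -> : (5 * 5 ^ (r - #|S|) = 5 ^ (r - #|S|.-1))%N.
  by rewrite -expnS; congr (5 ^ _)%N; lia.
rewrite natrB; last by rewrite leq_exp2l // leq_subr.
rewrite mulrBr mulr1 natrX lerD2l lerN2 natrX.
have -> : (5%:R : R) ^+ r = 5%:R ^+ (r - #|S|.-1) * 5%:R ^+ #|S|.-1.
  by rewrite -exprD subnK //; lia.
rewrite -mulrA ger_pMr ?exprn_gt0 // ler_pdivrMr ?exprn_gt0 // mul1r.
by apply: ler_weXn2l; rewrite ?ler1n //; lia.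
Qed.

(** Draw i is the vertex with index [be i] in copy [al i]. This is the condition under which the
    drawn vertices are shown to span a face. *)
Definition spanning_pair (al : {ffun 'I_r -> 'I_r}) (be : {ffun 'I_r -> 'I_N}) :=
  [forall c, (#|fiber al c| <= k)%N && [exists l : 'I_m, level_const (fiber al c) be l]].

(** The first factor bounds from below the share of [al] that crowd no copy; for each such [al], the
    second one bounds the share of suitable [be]. The hypothesis makes the second factor positive,
    so the two bounds can be multiplied. *)
Lemma card_spanning_pair : r%:R * q < 1 ->
  (1 - r%:R / ((k.+1)`!)%:R) * (1 - r%:R * q) * (r%:R ^+ r * N%:R ^+ r) <=
  (#|[set p : {ffun 'I_r -> 'I_r} * {ffun 'I_r -> 'I_N} | spanning_pair p.1 p.2]|)%:R.
Proof.
move=> rq.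
pose U := [set al : {ffun 'I_r -> 'I_r} | [forall c, (#|fiber al c| <= k)%N]].
have cardU : (1 - r%:R / ((k.+1)`!)%:R) * r%:R ^+ r <= (#|U|)%:R :> R.
  have UC : ~: U = [set al : {ffun 'I_r -> 'I_r} | [exists c, (k < #|fiber al c|)%N]].
    apply/finset.setP => al; rewrite !inE negb_forall; apply: eq_existsb => c.
    by rewrite -ltnNge.
  have := card_crowded k r0; rewrite -UC => h.
  have h1 : (#|~: U|)%:R <= r%:R / ((k.+1)`!)%:R * r%:R ^+ r :> R.
    by rewrite mulrAC ler_pdivlMr ?ltr0n ?fact_gt0 // -natrX -!natrM ler_nat.
  have h2 : (#|U|)%:R + (#|~: U|)%:R = r%:R ^+ r :> R.
    by rewrite -natrD cardsC card_ffun !card_ord natrX.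
  by rewrite mulrBl mul1r; lra.
have fibre_bound al : al \in U -> N%:R ^+ r * (1 - r%:R * q) <=
    (#|[set be : {ffun 'I_r -> 'I_N} | spanning_pair al be]|)%:R.
  rewrite inE => /forallP alk.
  (* A bad [be] shares no digit on the fiber of some copy; a union bound over the r copies
     follows. *)
  pose B c := [set be : {ffun 'I_r -> 'I_N} | [forall l : 'I_m, ~~ level_const (fiber al c) be l]].
  have sub : ~: [set be : {ffun 'I_r -> 'I_N} | spanning_pair al be] \subset \bigcup_c B c.
    apply/fintype.subsetP => be; rewrite !inE negb_forall => /existsP[c].
    by rewrite alk /= negb_exists => h; apply/bigcupP; exists c; rewrite ?inE.
  have h1 : (#|~: [set be : {ffun 'I_r -> 'I_N} | spanning_pair al be]|)%:R <= N%:R ^+ r * (r%:R * q) :> R.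
    apply: le_trans (_ : (\sum_c #|B c|)%N%:R <= _).
      by rewrite ler_nat (leq_trans (subset_leq_card sub)) // card_bigcup_le.
    rewrite natr_sum mulrCA mulr_natl -[X in _ *+ X](card_ord r) -sumr_const.
    by apply: ler_sum => c _; apply: card_spread_le; exact: alk.
  have h2 : (#|[set be : {ffun 'I_r -> 'I_N} | spanning_pair al be]|)%:R +
      (#|~: [set be : {ffun 'I_r -> 'I_N} | spanning_pair al be]|)%:R = N%:R ^+ r :> R.
    by rewrite -natrD cardsC card_ffun !card_ord natrX.
  by rewrite mulrBr mulr1; lra.
have cardE : #|[set p : {ffun 'I_r -> 'I_r} * {ffun 'I_r -> 'I_N} | spanning_pair p.1 p.2]| =
    (\sum_al #|[set be : {ffun 'I_r -> 'I_N} | spanning_pair al be]|)%N.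
  rewrite -sum1_card (eq_bigl (fun p => xpredT p.1 && spanning_pair p.1 p.2)) => [|p]; last by rewrite inE.
  rewrite -(pair_big_dep xpredT (fun al be => spanning_pair al be) (fun _ _ => 1%N)) /=.
  by apply: eq_bigr => al _; rewrite sum1_card; apply: eq_card => be; rewrite !inE.
rewrite cardE natr_sum (bigID [in U]) /=.
apply: le_trans (_ : \sum_(al in U) N%:R ^+ r * (1 - r%:R * q) <= _); last first.
  apply: le_trans (_ : \sum_(al in U) (#|[set be : {ffun 'I_r -> 'I_N} | spanning_pair al be]|)%:R <= _).
    by apply: ler_sum => al; exact: fibre_bound.
  by rewrite lerDl sumr_ge0.
rewrite sumr_const -[leRHS]mulr_natl.
have -> : (1 - r%:R / ((k.+1)`!)%:R) * (1 - r%:R * q) * (r%:R ^+ r * N%:R ^+ r) =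
  (1 - r%:R / ((k.+1)`!)%:R) * r%:R ^+ r * (N%:R ^+ r * (1 - r%:R * q)) by ring.
by apply: ler_wpM2r cardU; rewrite mulr_ge0 ?exprn_ge0 // subr_ge0 ltW.
Qed.

End Probability.

Local Open Scope classical_set_scope.
Local Open Scope ring_scope.

(** * Interpolation of absolutely monotone functions *)

Section Interpolation.
Variable R : realType.
Implicit Types (x y u b : R) (s t : seq R) (B : {poly R}).

Lemma rolle_pair (f f' : R -> R) x y : x < y ->
  (forall u, x <= u <= y -> is_derive u 1 f (f' u)) -> f x = 0 -> f y = 0 ->
  exists2 z, x < z < y & f' z = 0.
Proof.
move=> xy fd fx fy.
have [c cxy fc] : exists2 c, c \in `]x, y[%R & is_derive c 1 f 0.
  apply: Rolle => //; last by rewrite fx fy.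
  - move=> u; rewrite in_itv /= => /andP[xu uy].
    have := fd u; rewrite !ltW // => /(_ isT) h; exact: ex_derive.
  - apply: derivable_within_continuous => u; rewrite in_itv /= => xuy.
    have h := fd u xuy; exact: ex_derive.
move: cxy; rewrite in_itv /= => cxy; exists c => //.
have h : is_derive c 1 f (f' c) by apply: fd; case/andP: cxy => *; rewrite !ltW.
by rewrite -(@derive_val _ _ _ _ _ _ _ h) (@derive_val _ _ _ _ _ _ _ fc).
Qed.

Lemma path_lt_head_le_last x s : path <%R x s -> x <= last x s.
Proof.
elim: s x => //= y s IH x /andP[/ltW xy /IH]; exact: le_trans.
Qed.

(** One zero of [f'] in each gap between consecutive zeros of [f]. The new zeros are again sorted
    and stay left of b, so the step can be iterated. *)
Lemma rolle_path (f f' : R -> R) b x s :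
  (forall u, u < b -> is_derive u 1 f (f' u)) ->
  path <%R x s -> last x s < b -> all (fun u => f u == 0) (x :: s) ->
  exists t, [/\ size t = size s, path <%R x t, last x t <= last x s &
    all (fun u => f' u == 0) t].
Proof.
move=> fd; elim: s x => [|y s IH] x /=; first by exists [::].
move=> /andP[xy ys] lb /and3P[/eqP fx /eqP fy fs].
have [|t [tsz ty tl t0]] := IH y ys lb; first by rewrite /= fy eqxx.
have yl : y <= last y s by exact: path_lt_head_le_last.
have [|z /andP[xz zy] f'z] := @rolle_pair f f' x y xy _ fx fy.
  by move=> u /andP[_ uy]; apply: fd; apply: le_lt_trans uy (le_lt_trans yl lb).
exists (z :: t); split => /=.
- by rewrite tsz.
- by rewrite xz /=; case: (t) ty => //= w t' /andP[yw ->]; rewrite (lt_trans zy yw).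
- by case: (t) tl => //= tl; apply: le_trans yl; exact: ltW.
- by rewrite f'z eqxx.
Qed.

Lemma rolle_iter (g : nat -> R -> R) b n x s :
  (forall i u, u < b -> is_derive u 1 (g i) (g i.+1 u)) ->
  size s = n -> path <%R x s -> last x s < b -> all (fun u => g 0 u == 0) (x :: s) ->
  exists2 z, x <= z <= last x s & g n z = 0.
Proof.
elim: n g x s => [|n IH] g x s gd.
  by move=> /size0nil -> /= _ _ /andP[/eqP g0 _]; exists x; rewrite ?lexx.
move=> ssz xs lb g0; have [t [tsz xt tl t0]] := @rolle_path _ _ b x s (gd 0%N) xs lb g0.
case: t tsz xt tl t0 => [|y t]; first by rewrite ssz.
rewrite ssz /= => -[tsz] /andP[xy yt] tl t0.
have [z /andP[yz zl] gz] := IH (fun i => g i.+1) y t (fun i => gd i.+1) tsz yt (le_lt_trans tl lb) t0.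
by exists z => //; rewrite (le_trans (ltW xy) yz) (le_trans zl tl).
Qed.

Lemma rolle_uniq (g : nat -> R -> R) a b n s :
  (forall i u, u < b -> is_derive u 1 (g i) (g i.+1 u)) ->
  uniq s -> size s = n.+1 -> (forall u, u \in s -> [/\ a <= u, u < b & g 0%N u = 0]) ->
  exists2 z, a <= z < b & g n z = 0.
Proof.
move=> gd us ssz sP.
have mem_s u : (u \in sort <=%R s) = (u \in s) by rewrite mem_sort.
have: sorted <%R (sort <=%R s) by rewrite sort_lt_sorted.
have: size (sort <=%R s) = n.+1 by rewrite size_sort.
case E: (sort <=%R s) => [|x t] //= -[tsz] xt.
have sP' u : u \in x :: t -> [/\ a <= u, u < b & g 0%N u = 0].
  by rewrite -E mem_s; exact: sP.
have [||z /andP[xz zl] gz] := @rolle_iter g b n x t gd tsz xt.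
- by have [] := sP' (last x t) (mem_last _ _).
- by apply/seq.allP => u /sP'[_ _ /eqP].
exists z => //; have [ax _ _] := sP' x (mem_head _ _).
have [_ lb _] := sP' (last x t) (mem_last _ _).
by rewrite (le_trans ax xz) (le_lt_trans zl lb).
Qed.

(** Newton's form: a new node is served by a multiple of the product that vanishes at the earlier
    nodes. *)
Lemma ex_interpolation (f : R -> R) s : uniq s ->
  exists2 B : {poly R}, (size B <= size s)%N & forall u, u \in s -> B.[u] = f u.
Proof.
elim: s => [_|x s IH /= /andP[xs us]]; first by exists 0; rewrite ?size_poly0.
have [B Bsz BP] := IH us.
pose P := \prod_(v <- s) ('X - v%:P).
have Px : P.[x] != 0 by rewrite -[_ == 0]/(root P x) root_prod_XsubC.
exists (B + ((f x - B.[x]) / P.[x]) *: P).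
  rewrite (leq_trans (size_polyD _ _)) // geq_max (leq_trans Bsz) //=.
  by rewrite (leq_trans (size_scale_leq _ _)) // size_prod_XsubC.
move=> u; rewrite inE hornerD hornerZ => /orP[/eqP ->|us'].
  by rewrite divfK // addrC subrK.
have : root P u by rewrite root_prod_XsubC.
by rewrite rootE => /eqP ->; rewrite mulr0 addr0 BP.
Qed.

Lemma is_derive_sub_horner (f : R -> R) (df : R) B u :
  is_derive u 1 f df -> is_derive u 1 (fun v => f v - B.[v]) (df - B^`().[u]).
Proof. by move=> fd; apply: is_deriveB. Qed.

(* By Rolle, B' interpolates D 1 at n nodes not exceeding the last node of B, so by
   induction B is increasing to the right of that node, where it is positive. *)
Lemma interpolation_gt0 (D : nat -> R -> R) b n B x s :
  (forall i u, u < b -> is_derive u 1 (D i) (D i.+1 u)) ->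
  (forall i u, u < b -> 0 < D i u) ->
  size s = n -> path <%R x s -> last x s < b -> (size B <= n.+1)%N ->
  (forall u, u \in x :: s -> B.[u] = D 0%N u) ->
  forall u, last x s <= u -> 0 < B.[u].
Proof.
move=> + +; elim: n D B x s => [|n IH] D B x s Dd Dp.
  move=> /size0nil -> /= _ xb B1 BP u _.
  have := BP x (mem_head _ _); rewrite (size1_polyC B1) !hornerC => ->; exact: Dp.
move=> ssz xs lb Bsz BP u lu.
have [t [tsz xt tl t0]] : exists t, [/\ size t = size s, path <%R x t, last x t <= last x s &
    all (fun u => D 1%N u - B^`().[u] == 0) t].
  apply: (@rolle_path (fun v => D 0%N v - B.[v]) _ b) => //.
    by move=> v vb; apply: is_derive_sub_horner; exact: Dd.
  by apply/seq.allP => v /BP ->; rewrite subrr.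
case: t tsz xt tl t0 => [|y t]; first by rewrite ssz.
rewrite ssz /= => -[tsz] /andP[xy yt] tl t0.
have B'p v : last y t <= v -> 0 < B^`().[v].
  apply: (IH (fun i => D i.+1) _ y t (fun i => Dd i.+1) (fun i => Dp i.+1) tsz yt (le_lt_trans tl lb)).
  - have [->|B0] := eqVneq B 0; first by rewrite deriv0 size_poly0.
    by rewrite -ltnS (leq_trans (lt_size_deriv B0)).
  - have {}t0 : all (fun w => D 1%N w - B^`().[w] == 0) (y :: t) := t0.
    by move=> w wt; apply/esym/eqP; rewrite -subr_eq0; exact: (allP t0 _ wt).
have Bl : 0 < B.[last x s] by rewrite BP ?mem_last //; exact: Dp.
apply: lt_le_trans Bl _; move: lu; rewrite le_eqVlt => /predU1P[->//|lu].
have [|c] := @MVT R (horner B) (horner B^`()) _ _ lu.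
  exact/continuous_subspaceT/continuous_horner.
rewrite in_itv /= => /andP[lc cu] e; rewrite -subr_ge0 e mulr_ge0 // ?subr_ge0 ?ltW //.
by apply: B'p; rewrite (le_trans tl) // ltW.
Qed.

Lemma derivn_monic_prod s :
  (\prod_(v <- s) ('X - v%:P))^`(size s) = ((size s)`!%:R)%:P :> {poly R}.
Proof.
set P := \prod_(v <- s) _.
have Psz : size P = (size s).+1 by rewrite size_prod_XsubC.
have Pl : P`_(size s) = 1.
  have /monicP : P \is monic by apply: monic_prod_XsubC.
  by rewrite /lead_coef Psz.
apply/polyP => i; rewrite coef_derivn coefC; case: eqP => [->|/eqP i0].
  by rewrite addn0 Pl ffactnn.
by rewrite [P`__]nth_default ?mul0rn // Psz -addn1 leq_add2l lt0n.
Qed.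

(** The classical remainder formula. At a node both sides vanish; otherwise iterated Rolle is
    applied to [D 0] minus the interpolant [C] at the nodes together with u, whose derivative of
    order [size s] is the constant [kap] times a factorial. *)
Lemma interpolation_error (D : nat -> R -> R) a b B s u :
  (forall i v, v < b -> is_derive v 1 (D i) (D i.+1 v)) ->
  uniq s -> (size B <= size s)%N -> (forall v, v \in s -> B.[v] = D 0%N v) ->
  (forall v, v \in u :: s -> a <= v < b) ->
  exists2 z, a <= z < b &
    D 0%N u - B.[u] = D (size s) z / ((size s)`!)%:R * \prod_(v <- s) (u - v).
Proof.
move=> Dd us Bsz BP sab.
have [uins|uns] := boolP (u \in s).
  exists u; first by apply: sab; rewrite mem_head.
  by rewrite BP // subrr (big_rem u) //= subrr mul0r mulr0.
pose P := \prod_(v <- s) ('X - v%:P).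
have PE v : P.[v] = \prod_(w <- s) (v - w).
  by rewrite horner_prod; apply: eq_bigr => w _; rewrite !hornerE.
have Pu : P.[u] != 0 by rewrite -[_ == 0]/(root P u) root_prod_XsubC.
(* This choice makes [C] agree with [D 0] at u too. *)
pose kap := (D 0%N u - B.[u]) / P.[u].
pose C := B + kap *: P.
pose g i v := D i v - C^`(i).[v].
have [||||z zab gz] := @rolle_uniq g a b (size s) (u :: s) => //=.
- move=> i v vb; rewrite /g derivnS; apply: is_derive_sub_horner; exact: Dd.
- by rewrite uns.
- move=> v vs; have /andP[av vb] := sab v vs; split=> //.
  rewrite /g derivn0 /C hornerD hornerZ; move: vs; rewrite inE => /orP[/eqP ->|vs].
    by rewrite /kap divfK //; ring.
  have : root P v by rewrite root_prod_XsubC.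
  by rewrite rootE => /eqP ->; rewrite mulr0 addr0 BP // subrr.
exists z => //.
move: gz; rewrite /g /C derivnD derivnZ derivn_monic_prod.
rewrite derivn_poly0 // add0r !hornerE => /eqP; rewrite subr_eq0 => /eqP ->.
by rewrite mulfK ?pnatr_eq0 -?lt0n ?fact_gt0 // -PE /kap divfK.
Qed.

End Interpolation.

(** * Interpolating 1 / sqrt (1 - u), which is 1 / cos in the variable u = sin^2 *)

Section InvSqrt.
Variable R : realType.
Implicit Types (u z : R) (us : seq R) (B : {poly R}).

(** The rising factorial of 1/2: the i-th derivative of (1-u)^(-1/2) is this number times
    (1-u)^(-1/2-i). *)
Definition invsqrt_coef (i : nat) : R := \prod_(j < i) (j%:R + 2^-1).

Definition invsqrt_deriv (i : nat) (u : R) : R :=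
  invsqrt_coef i * (Num.sqrt (1 - u))^-1 ^+ (2 * i).+1.

Lemma invsqrt_coef_gt0 i : 0 < invsqrt_coef i.
Proof. by apply: prodr_gt0 => j _; have := ler0n R j; lra. Qed.

(** The first factor is 1/2 and each later factor j + 1/2 is at most j + 1. *)
Lemma invsqrt_coef_le i : invsqrt_coef i.+1 *+ 2 <= (i.+1)`!%:R.
Proof.
elim: i => [|i IH]; first by rewrite /invsqrt_coef big_ord1 /= (_ : 1`! = 1%N) //; lra.
rewrite /invsqrt_coef big_ord_recr /= -/(invsqrt_coef i.+1) factS natrM.
have -> : i.+2%:R = i.+1%:R + 1 :> R by rewrite natr1.
have := invsqrt_coef_gt0 i.+1; have := ler0n R i.+1; move: IH.
rewrite -[in X in X -> _](mulr_natr (invsqrt_coef _)) -(mulr_natr (_ * _)).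
move: (invsqrt_coef i.+1) (i.+1`!%:R : R) (i.+1%:R : R) => c F e IH e0 c0.
have : e * (c * 2) <= e * F by rewrite ler_wpM2l.
lra.
Qed.

Lemma invsqrt_deriv_gt0 i u : u < 1 -> 0 < invsqrt_deriv i u.
Proof.
move=> u1; rewrite mulr_gt0 ?invsqrt_coef_gt0 // exprn_gt0 // invr_gt0 sqrtr_gt0.
by rewrite subr_gt0.
Qed.

Lemma is_derive_invsqrt i u : u < 1 ->
  is_derive u 1 (invsqrt_deriv i) (invsqrt_deriv i.+1 u).
Proof.
move=> u1; have u0 : 0 < 1 - u by rewrite subr_gt0.
have s0 : Num.sqrt (1 - u) != 0 by rewrite gt_eqF // sqrtr_gt0.
have d1 : is_derive u 1 (fun v : R => 1 - v) (-1 : R).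
  by have := is_deriveB (is_derive_cst (1 : R) u 1) (is_derive_id u (1 : R)); rewrite sub0r.
have d2 : is_derive u 1 (fun v : R => Num.sqrt (1 - v)) (- (2 * Num.sqrt (1 - u))^-1).
  have dsq := is_derive1_sqrt u0.
  have := @is_derive1_comp _ Num.sqrt (fun v : R => 1 - v) u _ _ dsq d1.
  by rewrite mulrN1.
have d3 := @is_deriveV _ (fun v : R => Num.sqrt (1 - v)) u _ _ s0 d2.
have e3 : - Num.sqrt (1 - u) ^- 2 *: - (2 * Num.sqrt (1 - u))^-1 =
    2^-1 * (Num.sqrt (1 - u))^-1 ^+ 3 by rewrite /GRing.scale /=; field.
rewrite {}e3 in d3.
have d4 := @is_deriveX _ _ _ (2 * i).+1 _ _ _ d3.
have d5 := @is_deriveZ _ _ _ _ (invsqrt_coef i) _ _ _ d4.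
have -> : invsqrt_deriv i = invsqrt_coef i \*: (fun v : R => (Num.sqrt (1 - v))^-1) ^+ (2 * i).+1.
  by apply/funext => v; rewrite /invsqrt_deriv fctE.
apply: (is_derive_eq d5).
rewrite /invsqrt_deriv /invsqrt_coef big_ord_recr /= /GRing.scale /=.
set w := (Num.sqrt _)^-1; set c := \prod_(_ < _) _.
have -> : (2 * i.+1).+1 = (2 * i + 3)%N by lia.
by rewrite exprD -natr1 natrM; field.
Qed.

Lemma invsqrt_derivE u : invsqrt_deriv 0 u = (Num.sqrt (1 - u))^-1.
Proof. by rewrite /invsqrt_deriv /invsqrt_coef big_ord0 mul1r expr1. Qed.

(** With N nodes and w = (1-z)^(-1/2), the derivative over N! is at most (1/2) w 2^N, since w^2 <=
    2, and the product is at most 2^-N. What remains is w/2 < 1. *)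
Lemma invsqrt_deriv_error us u z : us != [::] ->
  (forall v, v \in u :: us -> 0 <= v < 2^-1) -> 0 <= z < 2^-1 ->
  `|invsqrt_deriv (size us) z / ((size us)`!)%:R * \prod_(v <- us) (u - v)| < 1.
Proof.
move=> us0 usP /andP[z0 z1].
set N := size us; have N0 : (0 < N)%N by rewrite /N; case: (us) us0.
have prod_le : `|\prod_(v <- us) (u - v)| <= 2^-1 ^+ N.
  rewrite /N; have : {in us, forall v, `|u - v| <= 2^-1}.
    move=> v vus; have := usP v; rewrite inE vus orbT => /(_ isT).
    by have := usP u (mem_head _ _); rewrite ler_norml; lra.
  elim: (us) => [|v s IH] h; first by rewrite big_nil normr1.
  rewrite big_cons normrM /= exprS ler_pM //; first exact: h (mem_head _ _).
  by apply: IH => w ws; apply: h; rewrite inE ws orbT.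
set w := (Num.sqrt (1 - z))^-1.
have w0 : 0 < w by rewrite invr_gt0 sqrtr_gt0; lra.
have w2 : w ^+ 2 <= 2.
  have h : 0 < 1 - z by lra.
  by rewrite exprVn sqr_sqrtr ?(ltW h) // -[leRHS]invrK lef_pV2 ?posrE ?invr_gt0 //; lra.
have wlt : w < 2 by nra.
have wN : w ^+ (2 * N) <= 2 ^+ N by rewrite exprM lerXn2r ?nnegrE // ltW // exprn_gt0.
have cN : invsqrt_coef N / N`!%:R <= 2^-1.
  rewrite ler_pdivrMr ?ltr0n ?fact_gt0 //.
  have := invsqrt_coef_le N.-1; rewrite prednK // -(mulr_natr (invsqrt_coef _)); lra.
have D0 : 0 < invsqrt_deriv N z / N`!%:R.
  by rewrite divr_gt0 ?ltr0n ?fact_gt0 // invsqrt_deriv_gt0 //; lra.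
rewrite normrM gtr0_norm //.
have -> : invsqrt_deriv N z / N`!%:R = invsqrt_coef N / N`!%:R * (w * w ^+ (2 * N)).
  by rewrite /invsqrt_deriv exprS mulrAC.
have hw : invsqrt_coef N / N`!%:R * (w * w ^+ (2 * N)) <= 2^-1 * (w * 2 ^+ N).
  apply: ler_pM => //.
  - by rewrite divr_ge0 // ltW // invsqrt_coef_gt0.
  - by rewrite mulr_ge0 ?exprn_ge0 // ltW.
  - by rewrite ler_pM2l.
apply: le_lt_trans (ler_pM _ _ hw prod_le) _ => //.
  by rewrite mulr_ge0 ?mulr_ge0 ?exprn_ge0 ?divr_ge0 // ltW // invsqrt_coef_gt0.
rewrite -mulrA -mulrA -exprMn divff ?pnatr_eq0 // expr1n; lra.
Qed.

(** Let F(u) = (1-u)^(-1/2). For u < 1/2 the error is below 1 <= F(u), so B lies strictly between 0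
    and 2F. For u >= 1/2 all nodes lie to the left: the error is nonnegative and B is positive by
    [interpolation_gt0]. Equality occurs only at nodes because the derivative in the remainder is
    positive. *)
Lemma ex_invsqrt_interpolation us : us != [::] -> uniq us ->
  (forall v, v \in us -> 0 <= v < 2^-1) ->
  exists2 B : {poly R}, (size B <= size us)%N & forall u, 0 <= u < 1 ->
    [/\ 0 < B.[u], B.[u] < 2 * (Num.sqrt (1 - u))^-1 &
        B.[u] = (Num.sqrt (1 - u))^-1 <-> u \in us].
Proof.
move=> us0 uus usP; have [B Bsz BP] := ex_interpolation (invsqrt_deriv 0) uus.
exists B => // u /andP[u0 u1]; rewrite -invsqrt_derivE.
have Dd (b : R) : b <= 1 -> forall i (v : R), v < b -> is_derive v 1 (invsqrt_deriv i) (invsqrt_deriv i.+1 v).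
  by move=> b1 i v vb; apply: is_derive_invsqrt; exact: lt_le_trans b1.
have phi_gt0 := invsqrt_deriv_gt0 0 u1.
have us_lt1 v : v \in u :: us -> 0 <= v < 1.
  by rewrite inE => /orP[/eqP ->|/usP]; lra.
have [z /andP[z0 z1] ez] := interpolation_error (Dd 1 (lexx _)) uus Bsz BP us_lt1.
have kap : 0 < invsqrt_deriv (size us) z / ((size us)`!)%:R.
  by rewrite divr_gt0 ?ltr0n ?fact_gt0 // invsqrt_deriv_gt0.
have iffP : B.[u] = invsqrt_deriv 0 u <-> u \in us.
  split=> [e|/BP //]; move: ez; rewrite e subrr => /esym/eqP.
  rewrite mulf_eq0 gt_eqF //= => /eqP/eqP; rewrite prodf_seq_eq0 => /hasP[v vus /=].
  by rewrite subr_eq0 => /eqP ->.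
have [u2|u2] := ltP u 2^-1.
  have us_lt2 v : v \in u :: us -> 0 <= v < 2^-1.
    by rewrite inE => /orP[/eqP ->|/usP]; lra.
  have h2 : 2^-1 <= 1 :> R by lra.
  have [y yb ey] := interpolation_error (Dd 2^-1 h2) uus Bsz BP us_lt2.
  have := invsqrt_deriv_error us0 us_lt2 yb; rewrite -ey.
  have phi1 : 1 <= invsqrt_deriv 0 u.
    have s0 : 0 < Num.sqrt (1 - u) by rewrite sqrtr_gt0; lra.
    rewrite invsqrt_derivE invf_ge1 //.
    by rewrite -[leRHS]sqrtr1 ler_wsqrtr //; lra.
  by rewrite ltr_norml => h; split=> //; lra.
split=> //; last first.
  have : 0 <= invsqrt_deriv 0 u - B.[u].
    rewrite ez mulr_ge0 ?(ltW kap) // big_seq; apply: prodr_ge0 => v /usP; lra.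
  lra.
have mem_s v : (v \in sort <=%R us) = (v \in us) by rewrite mem_sort.
have : sorted <%R (sort <=%R us) by rewrite sort_lt_sorted.
have: size (sort <=%R us) = size us by rewrite size_sort.
case E: (sort <=%R us) => [|x t] /= tsz xt.
  by move: us0; rewrite -size_eq0 -tsz.
have last_us : last x t \in us by rewrite -mem_s E mem_last.
apply: (@interpolation_gt0 _ invsqrt_deriv 1 (size t) B x t).
- exact: (Dd 1).
- by move=> i v; exact: invsqrt_deriv_gt0.
- by [].
- exact: xt.
- by have := usP _ last_us; lra.
- by rewrite tsz.
- by move=> v; rewrite -E mem_s => /BP.
- by have := usP _ last_us; lra.
Qed.

End InvSqrt.

(** * Odd trigonometric polynomials *)

Section OddTrig.
Variable R : realType.
Implicit Types (t a b z : R) (f g : R -> R) (P : {poly R}).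

(** Restrictions of linear functionals to the curve with coordinates [c t i]. With [Ucoord] and N =
    2q they are the odd trigonometric polynomials of degree at most 2q - 1; with [Psicoord] they are
    the functionals used to expose faces of P. *)
Definition lincomb (c : R -> nat -> R) (N : nat) (g : R -> R) : Prop :=
  exists a : nat -> R, forall t, g t = \sum_(0 <= i < N) a i * c t i.

Section Lincomb.
Variables (c : R -> nat -> R) (N : nat).
Implicit Types (e : R).
Local Notation span := (lincomb c N).

Lemma eq_lincomb f g : f =1 g -> span f -> span g.
Proof. by move=> fg [a aP]; exists a => t; rewrite -fg aP. Qed.

Lemma lincombD f g : span f -> span g -> span (fun t => f t + g t).
Proof.
move=> [a aP] [b bP]; exists (fun i => a i + b i) => t.
by rewrite aP bP -big_split; apply: eq_bigr => i _; rewrite mulrDl.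
Qed.

Lemma lincombZ e f : span f -> span (fun t => e * f t).
Proof.
move=> [a aP]; exists (fun i => e * a i) => t.
by rewrite aP big_distrr; apply: eq_bigr => i _ /=; rewrite mulrA.
Qed.

Lemma lincomb0 : span (fun=> 0).
Proof. by exists (fun=> 0) => t; rewrite big1 // => i _; rewrite mul0r. Qed.

Lemma lincomb_sum n (F : nat -> R -> R) : (forall i, (i < n)%N -> span (F i)) ->
  span (fun t => \sum_(0 <= i < n) F i t).
Proof.
elim: n => [|n IH] FP.
  by apply: eq_lincomb lincomb0 => t; rewrite big_geq.
apply: (@eq_lincomb (fun t => \sum_(0 <= i < n) F i t + F n t)).
  by move=> t; rewrite big_nat_recr.
by apply: lincombD; [apply: IH => i /ltnW; exact: FP|exact: FP].
Qed.

Lemma lincomb_coord i : (i < N)%N -> span (fun t => c t i).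
Proof.
move=> iN; exists (fun j => (j == i)%:R) => t.
rewrite (bigD1_seq i) ?mem_index_iota ?iota_uniq //= eqxx mul1r big1 ?addr0 //.
by move=> j /negPf ->; rewrite mul0r.
Qed.

End Lincomb.

Local Notation oddtrig q := (lincomb (Ucoord R) (2 * q)).

Lemma oddtrig_cos q j b : (j < q)%N -> oddtrig q (fun t => cos ((2 * j + 1)%N%:R * t + b)).
Proof.
move=> jq.
apply: (@eq_lincomb _ _ (fun t => cos b * Ucoord R t (2 * j) + - sin b * Ucoord R t (2 * j).+1)).
  move=> t; rewrite /Ucoord mul2n /= odd_double uphalf_double doubleK /= cosD mul2n; ring.
by apply: lincombD; apply: lincombZ; apply: lincomb_coord; lia.
Qed.

Lemma UcoordE i : exists b, forall t, Ucoord R t i = cos ((2 * i./2 + 1)%N%:R * t + b).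
Proof.
rewrite /Ucoord; case: (odd i); last by exists 0 => t; rewrite addr0.
by exists (- (pi / 2)) => t; rewrite cosBpihalf.
Qed.

Lemma oddtrig_le p q g : (p <= q)%N -> oddtrig p g -> oddtrig q g.
Proof.
move=> pq [a aP]; apply: (@eq_lincomb _ _ (fun t => \sum_(0 <= i < 2 * p) a i * Ucoord R t i)).
  by move=> t; rewrite aP.
apply: lincomb_sum => i ip; apply: lincombZ; apply: lincomb_coord; lia.
Qed.

Lemma cosM3 (x y z : R) : cos x * (cos y * cos z) =
  4^-1 * (cos (x + y + z) + cos (x - y - z) + cos (x + y - z) + cos (x - y + z)).
Proof. by rewrite !(cosD, sinD, cosN, sinN); field. Qed.

Lemma natr_odd2S j : (2 * j.+1 + 1)%N%:R = (2 * j + 1)%N%:R + 2 :> R.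
Proof. by rewrite -natrD; congr (_%:R); lia. Qed.

(** By the product formula the two cosines shift a frequency by -2, 0 or 2, which keeps it odd. *)
Lemma oddtrig_mul_cos2 q g a b : oddtrig q g ->
  oddtrig q.+1 (fun t => g t * (cos (t - a) * cos (t - b))).
Proof.
move=> [c cP].
apply: (@eq_lincomb _ _ (fun t => \sum_(0 <= i < 2 * q)
    c i * (Ucoord R t i * (cos (t - a) * cos (t - b))))).
  by move=> t; rewrite cP big_distrl; apply: eq_bigr => i _ /=; rewrite mulrA.
apply: lincomb_sum => i iq; apply: lincombZ; have [d dP] := UcoordE i.
have jq : (i./2 < q)%N by rewrite ltn_half_double -mul2n.
move: (i./2) jq dP => j jq dP.
pose s1 t : R := cos ((2 * j.+1 + 1)%N%:R * t + (d - a - b)).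
pose s2 t : R := cos ((2 * j + 1)%N%:R * t - t - t + (d + a + b)).
pose s3 t : R := cos ((2 * j + 1)%N%:R * t + (d - a + b)).
pose s4 t : R := cos ((2 * j + 1)%N%:R * t + (d + a - b)).
apply: (@eq_lincomb _ _ (fun t => 4^-1 * (s1 t + s2 t + s3 t + s4 t))).
  move=> t; rewrite dP cosM3 /s1 /s2 /s3 /s4 natr_odd2S.
  by congr (_ * (cos _ + cos _ + cos _ + cos _)); ring.
apply: lincombZ; apply: lincombD; last by apply: oddtrig_cos; lia.
apply: lincombD; last by apply: oddtrig_cos; lia.
apply: lincombD; first by apply: oddtrig_cos; lia.
(* Frequency 1 drops to -1, which evenness of cos turns back into 1. *)
rewrite /s2; case: j jq {dP s1 s2 s3 s4} => [|j] jq.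
  apply: (@eq_lincomb _ _ (fun t => cos ((2 * 0 + 1)%N%:R * t + - (d + a + b)))).
    by move=> t; rewrite -cosN; congr cos; ring.
  exact: oddtrig_cos.
apply: (@eq_lincomb _ _ (fun t => cos ((2 * j + 1)%N%:R * t + (d + a + b)))).
  by move=> t; congr cos; rewrite natr_odd2S; ring.
by apply: oddtrig_cos; lia.
Qed.

Lemma oddtrig_prod_cos j (s : seq R) : size s = (2 * j + 1)%N ->
  oddtrig j.+1 (fun t => \prod_(b <- s) cos (t - b)).
Proof.
elim: j s => [|j IH] s.
  case: s => [|b []] //= _.
  apply: (@eq_lincomb _ _ (fun t => cos ((2 * 0 + 1)%N%:R * t + - b))).
    by move=> t; rewrite big_seq1 mul1r.
  exact: oddtrig_cos.
rewrite mulnS; case: s => [|a [|b s]] //= /eqP.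
rewrite !eqSS => /eqP ssz.
apply: eq_lincomb (oddtrig_mul_cos2 a b (IH s ssz)) => t /=.
by rewrite !big_cons; ring.
Qed.

(** Horner's scheme: each factor sin(t-z)^2 = cos(t-z-pi/2)^2 raises q by one. *)
Lemma oddtrig_mul_sin2_poly q p g P z : (size P <= p.+1)%N -> oddtrig q g ->
  oddtrig (q + p) (fun t => g t * P.[sin (t - z) ^+ 2]).
Proof.
elim: p q g P => [|p IH] q g P Psz gq.
  rewrite addn0 (size1_polyC Psz); apply: eq_lincomb (lincombZ P`_0 gq) => t.
  by rewrite hornerC mulrC.
have g2 := oddtrig_mul_cos2 (z + pi / 2) (z + pi / 2) gq.
have sz : (size (drop_poly 1 P) <= p.+1)%N by rewrite size_drop_poly leq_subLR.
have h := IH _ _ _ sz g2.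
apply: (@eq_lincomb _ _ (fun t => P`_0 * g t +
    g t * (cos (t - (z + pi / 2)) * cos (t - (z + pi / 2))) *
      (drop_poly 1 P).[sin (t - z) ^+ 2])).
  move=> t; rewrite opprD addrA cosBpihalf -[in RHS](poly_take_drop 1 P).
  rewrite hornerD hornerM hornerXn expr1 (_ : take_poly 1 P = (P`_0)%:P).
    by rewrite hornerC expr2; ring.
  apply/polyP => i; rewrite coef_take_poly coefC; by case: i.
by apply: lincombD; [apply: lincombZ; apply: oddtrig_le gq; lia|rewrite -addSnnS].
Qed.

Lemma cos_sqrt (x : R) : 0 < cos x -> Num.sqrt (1 - sin x ^+ 2) = cos x.
Proof. by move=> x0; rewrite -cos2sin2 sqrtr_sqr gtr0_norm. Qed.

Lemma ex_oddtrig_peak k z (s : seq R) : s != [::] -> (size s <= k)%N ->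
  (forall a, a \in s -> 0 < cos (a - z) /\ sin (a - z) ^+ 2 < 2^-1) ->
  exists2 f, oddtrig (3 * k) f &
    forall t, f t <= 1 /\ (f t = 1 <-> exists2 a, a \in s & cos (t - z) = cos (a - z)).
Proof.
move=> s0 sk sP.
(* Points symmetric about z give the same node, hence [undup]. *)
pose us := undup [seq sin (a - z) ^+ 2 | a <- s].
have us_in u : u \in us -> 0 <= u < 2^-1.
  by rewrite mem_undup => /mapP[a /sP[_ ?] ->]; rewrite sqr_ge0.
have mem_u a : a \in s -> sin (a - z) ^+ 2 \in us.
  by move=> ain; rewrite mem_undup; apply/mapP; exists a.
have us0 : us != [::].
  have [a ain] : exists a, a \in s by case: (s) s0 => // a s' _; exists a; exact: mem_head.
  by apply/eqP => us0; have := mem_u a ain; rewrite us0.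
have [B Bsz BP] := ex_invsqrt_interpolation us0 (undup_uniq _) us_in.
have Bk : (size B <= k)%N.
  by rewrite (leq_trans Bsz) // (leq_trans (size_undup _)) // size_map.
have k0 : (0 < k)%N by apply: leq_trans sk; case: (s) s0.
pose H t := cos (t - z) * B.[sin (t - z) ^+ 2].
exists (fun t => (3 * H t - H t ^+ 3) / 2).
  pose C := (3 / 2) *: B - 2^-1 *: ((1 - 'X) * (B * (B * B))).
  have hX : (1 - 'X : {poly R}) = - ('X - 1%:P) by rewrite opprB.
  (* Since H^3 = cos(t-z) (1-u) B(u)^3 with u = sin(t-z)^2, the function is cos(t-z) C(u). The
     cosine takes q = 1, which leaves 3k - 1 for the degree of [C]. *)
  have Csz : (size C <= (3 * k).-1.+1)%N.
    rewrite prednK ?muln_gt0 // /C (leq_trans (size_polyD _ _)) // geq_max size_polyN.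
    rewrite (leq_trans (size_scale_leq _ _)) ?(leq_trans Bk) ?leq_pmull //=.
    rewrite (leq_trans (size_scale_leq _ _)) //.
    have h1 := size_polyMleq B B; have h2 := size_polyMleq B (B * B).
    have h3 := size_polyMleq (1 - 'X) (B * (B * B)).
    have h4 : size (1 - 'X : {poly R}) = 2 by rewrite hX size_polyN size_XsubC.
    rewrite h4 in h3; move: Bk k0 h1 h2 h3.
    move: (size B) (size (B * B)) (size (B * (B * B))) (size ((1 - 'X) * _)) => n1 n2 n3 n4.
    by clear; lia.
  have h1 : oddtrig 1 (fun t => cos ((2 * 0 + 1)%N%:R * t + - z)) by exact: oddtrig_cos.
  have := oddtrig_mul_sin2_poly z Csz h1.
  rewrite add1n prednK ?muln_gt0 //; apply: eq_lincomb => t.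
  by rewrite /C /H !hornerE /= -cos2sin2; field.
move=> t; pose y := cos (t - z); set u := sin (t - z) ^+ 2.
have uE : 1 - u = y ^+ 2 by rewrite /u -cos2sin2.
have Hgt : -2 < H t /\ (H t = 1 <-> exists2 a, a \in s & cos (t - z) = cos (a - z)).
  (* For y > 0, sqrt(1-u) = y and H is positive, equal to 1 only at the nodes. For y < 0, B < 2/|y|
     gives -2 < H < 0. For y = 0, H = 0. *)
  rewrite /H -/y -/u; have [y0|y0|y0] := ltgtP 0 y.
  - have u1 : 0 <= u < 1 by rewrite sqr_ge0 /=; nra.
    have [B0 B2 Biff] := BP u u1.
    have sq : Num.sqrt (1 - u) = y by rewrite /u cos_sqrt.
    split; first by nra.
    split=> [e|[a ain ya]].
      have /Biff : B.[u] = (Num.sqrt (1 - u))^-1.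
        by rewrite sq; apply: (mulfI (lt0r_neq0 y0)); rewrite e divff ?lt0r_neq0.
      rewrite mem_undup => /mapP[a ain ua]; exists a => //.
      have [a0 _] := sP a ain.
      by rewrite -/y -sq ua cos_sqrt.
    have -> : B.[u] = (Num.sqrt (1 - u))^-1.
      apply/Biff; rewrite (_ : u = sin (a - z) ^+ 2) ?mem_u //.
      by rewrite /u !sin2cos2 -ya.
    by rewrite sq divff // lt0r_neq0.
  - have u1 : 0 <= u < 1 by rewrite sqr_ge0 /=; nra.
    have [B0 B2 Biff] := BP u u1.
    have sq : Num.sqrt (1 - u) = - y by rewrite uE sqrtr_sqr ltr0_norm.
    split.
      have h : - y * B.[u] < 2; last by lra.
      by rewrite -ltr_pdivlMl ?oppr_gt0 // mulrC -sq.
    split=> [e|[a /sP[a0 _] ya]]; first by nra.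
    by move: y0; rewrite ya; lra.
  - rewrite -y0 mul0r; split; first by lra.
    split=> [e|[a /sP[a0 _] ya]]; first by lra.
    by move: y0; rewrite ya; lra.
have [Hm2 Hiff] := Hgt; move: (H t) Hm2 Hiff => h hm2 hiff.
have e : 1 - (3 * h - h ^+ 3) / 2 = (h - 1) ^+ 2 * (h + 2) / 2 by field.
split.
  by rewrite -subr_ge0 e divr_ge0 // mulr_ge0 ?sqr_ge0 //; lra.
rewrite -hiff; split=> [e1|->]; last by field.
move: e; rewrite e1 subrr => /esym/eqP; rewrite mulf_eq0 mulf_eq0 sqrf_eq0 subr_eq0.
by case/orP => [/orP[/eqP //|]|] => /eqP; lra.
Qed.

End OddTrig.

(** * Functionals exposing finite sets of points of the curve *)

Section Exposing.
Variable R : realType.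
Implicit Types (t a b x y z : R) (f g h : R -> R) (L T A : seq R).
Local Notation oddtrig q := (lincomb (Ucoord R) (2 * q)).

Lemma cos1_sin0 x : cos x = 1 -> sin x = 0.
Proof. by move=> c1; apply: cos1sin0; rewrite c1 normr1. Qed.

Lemma cos1_mulr_natl n x : cos x = 1 -> cos (n%:R * x) = 1.
Proof.
move=> c1; suff [] : cos (n%:R * x) = 1 /\ sin (n%:R * x) = 0 by [].
elim: n => [|n [IHc IHs]]; first by rewrite mul0r cos0 sin0.
by rewrite -natr1 mulrDl mul1r cosD sinD IHc IHs c1 (cos1_sin0 c1) !(mulr0, mul0r, mulr1, subr0, addr0).
Qed.

Lemma cos_mulz2pi (n : int) : cos (n%:~R * (pi *+ 2)) = 1 :> R.
Proof.
case: n => n; first by apply: cos1_mulr_natl; exact: cos2pi.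
by rewrite NegzE rmorphN /= mulNr cosN; apply: cos1_mulr_natl; exact: cos2pi.
Qed.

(* Equality of angles modulo 2 pi is expressed throughout as cos (x - y) = 1. *)
Lemma cos1B x y : cos (x - y) = 1 -> cos x = cos y /\ sin x = sin y.
Proof.
move=> c1; have s0 := cos1_sin0 c1.
rewrite -[x](subrK y) (cosD (x - y)) (sinD (x - y)) c1 s0.
by rewrite !(mulr0, mul0r, mul1r, subr0, add0r).
Qed.

Lemma cos1B_trans x y z : cos (x - y) = 1 -> cos (y - z) = 1 -> cos (x - z) = 1.
Proof. by move=> /cos1B[cxy sxy]; rewrite !cosB cxy sxy. Qed.

Lemma cos1B_sym x y : cos (x - y) = 1 -> cos (y - x) = 1.
Proof. by rewrite -cosN opprB. Qed.

(** Reduce x to r in [0, 2 pi); if r > 0 then sin(r/2) > 0 and cos r = 1 - 2 sin(r/2)^2 < 1. *)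
Lemma cos_eq1 x : cos x = 1 -> exists n : int, x = n%:~R * (pi *+ 2).
Proof.
move=> c1; have p2 : 0 < pi *+ 2 :> R by rewrite pmulrn_lgt0 // pi_gt0.
pose n := Num.floor (x / (pi *+ 2)); exists n.
pose r := x - n%:~R * (pi *+ 2).
have xr : x = r + n%:~R * (pi *+ 2) by rewrite subrK.
have r0 : 0 <= r by rewrite subr_ge0 -ler_pdivlMr // floor_le.
have r2 : r < pi *+ 2.
  by rewrite ltrBlDl -[X in _ + X]mul1r -mulrDl -ltr_pdivrMr // -[1]/(1%:~R) -intrD lt_succ_floor.
have : cos r = 1.
  have : cos (x - r) = 1 by rewrite xr addrC addKr cos_mulz2pi.
  by move=> /cos1B[<-].
move=> cr; have [r_gt0|r_lt0|r_eq0] := ltgtP 0 r; last 2 first.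
- by move: r0; rewrite leNgt r_lt0.
- by rewrite xr -r_eq0 add0r.
have s0 : 0 < sin (r / 2).
  by apply: sin_gt0_pi; rewrite divr_gt0 //= ltr_pdivrMr // mulr_natr.
have : cos ((r / 2) *+ 2) = 1 by rewrite -mulr_natr divfK.
by rewrite cos_mulr2n cos2sin2 mulr2n; nra.
Qed.

Lemma Ucoord_cos1B x y i : cos (x - y) = 1 -> Ucoord R x i = Ucoord R y i.
Proof.
move=> c1; have [ec es] : cos ((2 * i./2 + 1)%N%:R * x) = cos ((2 * i./2 + 1)%N%:R * y) /\
    sin ((2 * i./2 + 1)%N%:R * x) = sin ((2 * i./2 + 1)%N%:R * y).
  by apply: cos1B; rewrite -mulrBr; exact: cos1_mulr_natl.
by rewrite /Ucoord ec es.
Qed.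

Lemma oddtrig_cos1B q g x y : oddtrig q g -> cos (x - y) = 1 -> g x = g y.
Proof.
by move=> [a aP] c1; rewrite !aP; apply: eq_bigr => i _; rewrite (Ucoord_cos1B _ c1).
Qed.

(* Lagrange interpolation with nodes pairwise distinct modulo pi: a product of factors
   sin (t - a), completed by cos (t - z) when needed to make the degree odd. *)
Lemma ex_oddtrig_node q z L : z \in L -> (size L <= 2 * q)%N ->
  (forall a, a \in L -> sin (z - a) = 0 -> cos (a - z) = 1) ->
  exists g, [/\ oddtrig q g, g z = 1 & forall a, a \in L -> cos (a - z) = 1 \/ g a = 0].
Proof.
move=> zL Lq LP.
(* The factor cos(t - (a + pi/2)) equals sin(t - a) and vanishes at a. *)
pose s := [seq a + pi / 2 | a <- L & cos (a - z) != 1].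
pose s' := if odd (size s) then s else z :: s.
(* The point z itself is filtered out, which leaves room for the parity factor. *)
have sL : (size s < size L)%N.
  rewrite size_map size_filter -(count_predC (fun a => cos (a - z) != 1) L) -ltn_subLR ?subnn //.
  by rewrite -has_count; apply/hasP; exists z => //=; rewrite subrr cos0 eqxx.
have odd_s' : odd (size s') by rewrite /s'; case: ifP => // /negbT h /=; rewrite h.
have s'q : (size s' <= (2 * q).-1)%N.
  rewrite /s'; case: ifP => [_|/negbT so /=]; first by lia.
  (* An even length below 2q is at most 2q - 2, so one more factor fits. *)
  have : size s != (2 * q).-1 by apply: contraNneq so => ->; lia.
  by move: sL => /leq_trans/(_ Lq); move: (size s) => n; lia.
have s'z : \prod_(b <- s') cos (z - b) != 0.
  have : \prod_(b <- s) cos (z - b) != 0.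
    rewrite prodf_seq_neq0; apply/allP => _ /mapP[a + ->] /=.
    rewrite mem_filter => /andP[/eqP az aL].
    by rewrite opprD addrA cosBpihalf; apply/eqP => /(LP a aL).
  by rewrite /s'; case: ifP => // _; rewrite big_cons subrr cos0 mul1r.
exists (fun t => (\prod_(b <- s') cos (z - b))^-1 * \prod_(b <- s') cos (t - b)); split.
- apply: lincombZ.
  have e : size s' = (2 * (size s')./2 + 1)%N.
    by rewrite -[LHS]odd_double_half odd_s' mul2n addnC.
  by apply: oddtrig_le (oddtrig_prod_cos e); lia.
- by rewrite mulVf.
move=> a aL; have [az|az] := eqVneq (cos (a - z)) 1; [by left|right].
have as' : a + pi / 2 \in s'.
  have : a + pi / 2 \in s by apply/mapP; exists a => //; rewrite mem_filter az.
  by rewrite /s'; case: ifP => // _ h; rewrite inE h orbT.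
by rewrite [X in _ * X](big_rem _ as') /= opprD addrA subrr add0r cosN cos_pihalf mul0r mulr0.
Qed.

(** Sum of the functions of [ex_oddtrig_node] over T, one point at a time; a point congruent modulo
    2 pi to one already treated adds nothing. The last hypothesis excludes antipodal pairs in L. *)
Lemma ex_oddtrig_separating q L T : {subset T <= L} -> (size L <= 2 * q)%N ->
  (forall a b, a \in L -> b \in L -> sin (a - b) = 0 -> cos (a - b) = 1) ->
  exists g, [/\ oddtrig q g, forall a, a \in T -> g a = 1 &
    forall a, a \in L -> (exists2 b, b \in T & cos (a - b) = 1) \/ g a = 0].
Proof.
move=> + Lq LP; elim: T => [_|z T IH TL].
  by exists (fun=> 0); split=> //; [exact: lincomb0|move=> a _; right].
have [|g [gq gT gL]] := IH; first by move=> a aT; apply: TL; rewrite inE aT orbT.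
have zL : z \in L by apply: TL; exact: mem_head.
have [[b bT zb]|gz] := gL z zL.
  exists g; split => // a.
    by rewrite inE => /orP[/eqP ->|/gT //]; rewrite (oddtrig_cos1B gq zb) gT.
  by move=> /gL[[c cT ac]|]; [left; exists c => //; rewrite inE cT orbT|right].
have [|l [lq lz lL]] := ex_oddtrig_node zL Lq.
  by move=> a aL s0; apply: cos1B_sym; apply: LP.
exists (fun t => g t + l t); split; first exact: lincombD.
  move=> a; rewrite inE => /orP[/eqP ->|aT]; first by rewrite gz lz add0r.
  have aL : a \in L by apply: TL; rewrite inE aT orbT.
  have [az|->] := lL a aL; last by rewrite gT ?addr0.
  by move: gz; rewrite -(oddtrig_cos1B gq az) gT // => /eqP; rewrite oner_eq0.
move=> a aL; have [[b bT ab]|ga] := gL a aL.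
  by left; exists b => //; rewrite inE bT orbT.
have [az|la] := lL a aL; first by left; exists z => //; rewrite mem_head.
by right; rewrite ga la addr0.
Qed.

Lemma lincomb_Psi k m i g : (i <= m)%N -> oddtrig (3 * k) g ->
  lincomb (Psicoord R k) (6 * k * m.+1) (fun t => g ((5 ^ i)%N%:R * t)).
Proof.
move=> im [a aP].
apply: (@eq_lincomb _ _ _ (fun t => \sum_(0 <= j < 2 * (3 * k)) a j * Ucoord R ((5 ^ i)%N%:R * t) j)).
  by move=> t; rewrite aP.
apply: lincomb_sum => j jk; apply: lincombZ.
have jk6 : (j < 6 * k)%N by lia.
have k0 : (0 < 6 * k)%N by lia.
apply: (@eq_lincomb _ _ _ (fun t => Psicoord R k t (i * (6 * k) + j))).
  by move=> t; rewrite /Psicoord divnMDl // divn_small // addn0 modnMDl modn_small.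
by apply: lincomb_coord; nia.
Qed.

Lemma ex_small_perturbation A f g : (forall t, t \in A -> f t <= 1) ->
  exists2 e, 0 < e < 1 & forall t, t \in A -> f t < 1 -> (1 - e) * f t + e * g t < 1.
Proof.
(* Strengthened to all smaller e', so that the induction on A can pass to a minimum. *)
move=> fA; suff [e e0 eP] : exists2 e, 0 < e < 1 & forall e', 0 < e' <= e ->
    forall t, t \in A -> f t < 1 -> (1 - e') * f t + e' * g t < 1.
  by exists e => //; apply: eP; case/andP: e0 => ->; rewrite lexx.
elim: A fA => [_|a A IH fA]; first by exists 2^-1 => //; apply/andP; lra.
have [|e /andP[e0 e1] eP] := IH; first by move=> t tA; apply: fA; rewrite inE tA orbT.
have [fa|fa] := ltP (f a) 1; last first.
  exists e; first by rewrite e0.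
  by move=> e' he t; rewrite inE => /orP[/eqP ->|/eP]; [lra|exact].
(* Below this threshold e' (g - f) < 1 - f at a; the added 1 keeps the denominator positive, and d/2
   gives strictness. *)
pose d := (1 - f a) / (1 + `|g a - f a|).
have D0 : 0 < 1 + `|g a - f a| by have := normr_ge0 (g a - f a); lra.
have d0 : 0 < d by rewrite divr_gt0 //; lra.
exists (Num.min e (d / 2)); first by rewrite lt_min e0 gt_min e1 divr_gt0.
move=> e' /andP[e'0]; rewrite le_min => /andP[e'e e'd] t.
rewrite inE => /orP[/eqP -> _|tA ft]; last by apply: eP => //; rewrite e'0.
have h1 : e' * (1 + `|g a - f a|) < 1 - f a by rewrite -ltr_pdivlMr // -/d; lra.
have h2 : g a - f a <= `|g a - f a| by exact: ler_norm.
have h3 : e' * (g a - f a) <= e' * (1 + `|g a - f a|) by apply: ler_wpM2l; lra.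
lra.
Qed.

(* A face of a face is a face: (1 - e) f + e g, with e small on the finite set A. *)
Lemma lincomb_refine c N A f g : lincomb c N f -> lincomb c N g ->
  (forall t, t \in A -> f t <= 1) ->
  (forall t, t \in A -> f t = 1 -> g t = 1 \/ g t < 1) ->
  exists2 h, lincomb c N h & forall t, t \in A -> h t <= 1 /\ (h t = 1 <-> f t = 1 /\ g t = 1).
Proof.
move=> fc gc fA gA; have [e /andP[e0 e1] eP] := ex_small_perturbation g fA.
exists (fun t => (1 - e) * f t + e * g t); first by apply: lincombD; exact: lincombZ.
move=> t tA; have := fA t tA; rewrite le_eqVlt => /predU1P[ft|ft].
  by rewrite ft; have [->|gt] := gA t tA ft; [split; [lra|split=> _ //; lra]|
    split; [nra|split=> [|[_]] ?; nra]].
by have := eP t tA ft => h; split; [exact: ltW|split=> [|[]]; lra].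
Qed.

End Exposing.

(** * Descent through the levels 5^i t *)

Section Levels.
Variable R : realType.
Implicit Types (t a b x y z : R) (f g h : R -> R) (L T A : seq R).
Local Notation oddtrig q := (lincomb (Ucoord R) (2 * q)).
Local Notation pow5 i := ((5 ^ i)%N%:R : R).

Lemma cos_eq_cases x y : cos x = cos y -> cos (x - y) = 1 \/ cos (x + y) = 1.
Proof.
move=> cxy; have : sin x ^+ 2 = sin y ^+ 2 by rewrite !sin2cos2 cxy.
have := cos2Dsin2 y; move=> h /eqP; rewrite eqf_sqr => /orP[] /eqP s.
  by left; rewrite cosB cxy s -h; ring.
by right; rewrite cosD cxy s -h; ring.
Qed.

Lemma sin0_cos x : sin x = 0 -> cos x <> -1 -> cos x = 1.
Proof.
move=> s0 cN; have := cos2Dsin2 x; rewrite s0 expr0n addr0 => /eqP.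
by rewrite sqrf_eq1 => /orP[] /eqP.
Qed.

(** Multiplication by the odd number 5 preserves antipodality: 5x = x + 4x, and 4x is a multiple of
    2 pi. *)
Lemma cos5_N1 x : cos x = -1 -> cos (5 * x) = -1.
Proof.
move=> c1; have c2 : cos (x *+ 2) = 1 by rewrite cos_mulr2n c1 sqrrN expr1n mulr2n addrK.
have c4 := cos1_mulr_natl 2 c2.
have -> : 5 * x = 2%:R * (x *+ 2) - (- x) by rewrite -mulr_natr; ring.
have [|-> _] := @cos1B R (2%:R * (x *+ 2) - - x) x; last by [].
by rewrite opprK addrK.
Qed.

Lemma cos5_root x : cos (5 * x) = 1 ->
  exists2 l : nat, (l < 5)%N & cos (x - l%:R * (pi *+ 2 / 5)) = 1.
Proof.
move=> /cos_eq1[n en]; exists `|(n %% 5)%Z|%N; first by lia.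
have e : n = ((n %/ 5)%Z * 5 + `|(n %% 5)%Z|%N%:Z) by lia.
have -> : x - `|(n %% 5)%Z|%:R * (pi *+ 2 / 5) = (n %/ 5)%Z%:~R * (pi *+ 2).
  have -> : x = (5 * x) / 5 by field.
  by rewrite en {1}e intrD intrM -pmulrn; field.
exact: cos_mulz2pi.
Qed.

(** At level 0 the exposed points of A are those of T modulo 2 pi; at level i they include every
    point with the same image under t -> 5^i t as a point of T. *)
Definition exposes k m A T i := exists2 h,
  lincomb (Psicoord R k) (6 * k * m.+1) h &
  forall t, t \in A -> h t <= 1 /\
    (h t = 1 <-> exists2 b, b \in T & cos (pow5 i * t - pow5 i * b) = 1).

(** The peak function f equals 1 at the images [S] and at their reflections in z; refining by a
    function g that is 1 on [S] and 0 at the other points removes unwanted reflections. All these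
    points have positive cosine relative to z, so no two are antipodal. *)
Lemma exposes_arc k m A T i z : (i <= m)%N -> T != [::] -> (size T <= k)%N ->
  (forall b, b \in T -> 0 < cos (pow5 i * b - z) /\ sin (pow5 i * b - z) ^+ 2 < 2^-1) ->
  exposes k m A T i.
Proof.
move=> im T0 Tk TP.
pose S := [seq pow5 i * b | b <- T].
have SP a : a \in S -> 0 < cos (a - z) /\ sin (a - z) ^+ 2 < 2^-1.
  by move=> /mapP[b bT ->]; exact: TP.
have S0 : S != [::] by rewrite -size_eq0 size_map size_eq0.
have Sk : (size S <= k)%N by rewrite size_map.
have [f fk fP] := ex_oddtrig_peak S0 Sk SP.
(* At most 2k points, within the 6k that degree 6k - 1 can separate. *)
pose L := S ++ [seq z *+ 2 - a | a <- S].
have Lcos a : a \in L -> 0 < cos (a - z).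
  rewrite mem_cat => /orP[/SP[]//|/mapP[b /SP[b0 _] ->]].
  by rewrite (_ : _ - z = - (b - z)) ?cosN // mulr2n; ring.
have LP a b : a \in L -> b \in L -> sin (a - b) = 0 -> cos (a - b) = 1.
  move=> /Lcos a0 /Lcos b0 s0; apply: sin0_cos => // cN.
  have e : a - z = (a - b) + (b - z) by ring.
  by move: a0; rewrite e cosD s0 cN mul0r subr0 mulN1r; lra.
have SL : {subset S <= L} by move=> a aS; rewrite mem_cat aS.
have [|g [gk gS gL]] := @ex_oddtrig_separating _ (3 * k) L S SL _ LP.
  by rewrite size_cat !size_map; move: (size T) Tk => n; lia.
have f1L (x : R) : f x = 1 -> exists2 a, a \in L & cos (x - a) = 1.
  move=> /(proj2 (fP x))[a aS /cos_eq_cases[h|h]].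
    by exists a; [exact: SL|rewrite -h; congr cos; ring].
  exists (z *+ 2 - a); first by rewrite mem_cat; apply/orP; right; apply/mapP; exists a.
  by rewrite -h mulr2n; congr cos; ring.
have [t tA|t tA ft|h hk hP] := @lincomb_refine R _ _ A _ _ (lincomb_Psi im fk) (lincomb_Psi im gk).
- exact: (proj1 (fP _)).
- have [a aL xa] := f1L _ ft; rewrite (oddtrig_cos1B gk xa).
  by have [[b bS ab]|->] := gL a aL; [left; rewrite (oddtrig_cos1B gk ab) gS|right].
exists h => // t tA; have [h1 hiff] := hP t tA; split=> //; rewrite hiff.
split=> [[ft gt]|[b bT tb]].
  have [a aL xa] := f1L _ ft.
  have [[_ /mapP[b bT ->] ab]|ga] := gL a aL; first by exists b => //; exact: cos1B_trans ab.
  by move: gt; rewrite (oddtrig_cos1B gk xa) ga => /eqP; rewrite eq_sym oner_eq0.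
have bS : pow5 i * b \in S by exact: map_f.
split; last by rewrite (oddtrig_cos1B gk tb) gS.
by rewrite (oddtrig_cos1B fk tb); apply/(proj2 (fP _)); exists (pow5 i * b).
Qed.

(* The at most k points have at most 5k preimages under t -> 5 t, again without
   antipodal pairs, and 5k <= 6k. *)
Lemma exposes_pred k m A T i : (i < m)%N -> (size T <= k)%N ->
  (forall a b, a \in T -> b \in T -> cos (pow5 i.+1 * a - pow5 i.+1 * b) <> -1) ->
  exposes k m A T i.+1 -> exposes k m A T i.
Proof.
move=> im Tk TP [f fk fP].
have p5 x y : pow5 i.+1 * x - pow5 i.+1 * y = 5 * (pow5 i * x - pow5 i * y).
  by rewrite expnS natrM; ring.
pose S := [seq pow5 i * b | b <- T].
pose L := [seq a + l%:R * (pi *+ 2 / 5) | a <- S, l <- iota 0 5].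
have SL : {subset S <= L}.
  move=> a aS; apply/allpairsP; exists (a, 0%N) => /=; split=> //.
  by rewrite mul0r addr0.
have LP a b : a \in L -> b \in L -> sin (a - b) = 0 -> cos (a - b) = 1.
  move=> /allpairsP[[_ l] /= [/mapP[x xT ->] _ ->]].
  move=> /allpairsP[[_ l'] /= [/mapP[y yT ->] _ ->]] s0.
  (* Antipodal preimages would have antipodal images, since the shifts by multiples of 2 pi / 5
     become full turns. *)
  apply: sin0_cos => // /cos5_N1 cN; apply: (TP x y xT yT); rewrite p5 -cN.
  set u := pow5 i * x; set v := pow5 i * y.
  suff /cos1B[] : cos (5 * (u - v) - 5 * (u + l%:R * (pi *+ 2 / 5) - (v + l'%:R * (pi *+ 2 / 5)))) = 1 by [].
  apply: etrans (cos_mulz2pi R (l'%:Z - l%:Z)); rewrite intrD intrN; congr cos.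
  by rewrite -!pmulrn; field.
have [|g [gk gS gL]] := @ex_oddtrig_separating _ (3 * k) L S SL _ LP.
  by rewrite size_allpairs size_map size_iota; lia.
have f1L t : t \in A -> f t = 1 -> exists2 a, a \in L & cos (pow5 i * t - a) = 1.
  move=> tA /(proj2 (fP t tA))[b bT]; rewrite p5 => /cos5_root[l l5 h].
  exists (pow5 i * b + l%:R * (pi *+ 2 / 5)); last by rewrite opprD addrA.
  by apply/allpairsP; exists (pow5 i * b, l); split; [exact: map_f|rewrite mem_iota|].
have [t tA|t tA ft|h hk hP] := @lincomb_refine R _ _ A _ _ fk (lincomb_Psi (ltnW im) gk).
- exact: (proj1 (fP t tA)).
- have [a aL xa] := f1L _ tA ft; rewrite (oddtrig_cos1B gk xa).
  by have [[b bS ab]|->] := gL a aL; [left; rewrite (oddtrig_cos1B gk ab) gS|right].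
exists h => // t tA; have [h1 hiff] := hP t tA; split=> //; rewrite hiff.
split=> [[ft gt]|[b bT tb]].
  have [a aL xa] := f1L _ tA ft.
  have [[_ /mapP[b bT ->] ab]|ga] := gL a aL; first by exists b => //; exact: cos1B_trans ab.
  by move: gt; rewrite (oddtrig_cos1B gk xa) ga => /eqP; rewrite eq_sym oner_eq0.
have bS : pow5 i * b \in S by exact: map_f.
split; last by rewrite (oddtrig_cos1B gk tb) gS.
by apply/(proj2 (fP t tA)); exists b => //; rewrite p5; exact: (cos1_mulr_natl 5).
Qed.

(** Start at level i with the arc and descend to level 0. The absence of antipodal pairs passes
    downwards because an antipodal pair at one level stays antipodal at the next higher one. *)
Lemma ex_exposing k m A T i z : (i <= m)%N -> T != [::] -> (size T <= k)%N ->
  (forall b, b \in T -> 0 < cos (pow5 i * b - z) /\ sin (pow5 i * b - z) ^+ 2 < 2^-1) ->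
  exists2 h, lincomb (Psicoord R k) (6 * k * m.+1) h &
  forall t, t \in A -> h t <= 1 /\ (h t = 1 <-> exists2 b, b \in T & cos (t - b) = 1).
Proof.
move=> im T0 Tk TP; have hi := exposes_arc A im T0 Tk TP.
have TN a b : a \in T -> b \in T -> cos (pow5 i * a - pow5 i * b) <> -1.
  move=> /TP[a0 _] /TP[b0 _] cN.
  have s0 : sin (pow5 i * a - pow5 i * b) = 0 by apply: cos1sin0; rewrite cN normrN1.
  have e : pow5 i * a - z = (pow5 i * a - pow5 i * b) + (pow5 i * b - z) by ring.
  by move: a0; rewrite e cosD s0 cN mul0r subr0 mulN1r; lra.
suff [h hk hP] : exposes k m A T 0.
  exists h => // t tA; have [h1 ->] := hP t tA; split=> //.
  by split=> -[b bT tb]; exists b => //; move: tb; rewrite expn0 !mul1r.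
elim: i im hi TN {TP} => // i IH im hi TN; apply: IH; first exact: ltnW.
  exact: exposes_pred hi.
move=> a b aT bT /cos5_N1 cN; apply: (TN a b aT bT).
by rewrite -cN expnS natrM; congr cos; ring.
Qed.

End Levels.

(** * Convex hulls and the faces of Q *)

Section Convexity.
Variables (R : realType) (d : nat).
Implicit Types (S : set 'rV[R]_d) (a x v : 'rV[R]_d).
Local Notation conv := (Defs.conv R d).
Local Notation dotv := (dotv R d).

Lemma conv_sum (I : finType) S (p : I -> 'rV[R]_d) (w : I -> R) :
  (forall i, S (p i)) -> (forall i, 0 <= w i) -> \sum_i w i = 1 ->
  conv S (\sum_i w i *: p i).
Proof.
move=> Sp w0 w1; exists #|I|, (p \o enum_val), (w \o enum_val); split; first by move=> i; exact: Sp.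
split; first by move=> i; exact: w0.
have bij : {on predT, bijective (@enum_val I predT)} by apply: onW_bij; exact: enum_val_bij.
by split; [rewrite -w1|]; rewrite (reindex _ bij).
Qed.

Lemma sub_conv S : S `<=` conv S.
Proof.
move=> x Sx; have -> : x = \sum_(i : 'I_1) 1 *: x by rewrite big_ord1 scale1r.
by apply: conv_sum => //; rewrite big_ord1.
Qed.

Lemma conv_subset S S' : S `<=` S' -> conv S `<=` conv S'.
Proof. by move=> SS' x [N [p [w [Sp hw]]]]; exists N, p, w; split=> // i; exact: SS'. Qed.

Lemma conv_idem S : conv (conv S) `<=` conv S.
Proof.
move=> x [N [p [w [Sp [w0 [w1 ->]]]]]].
have /choice[M hM] : forall i, exists M : nat, exists q : 'I_M -> 'rV[R]_d, exists u : 'I_M -> R,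
  (forall j, S (q j)) /\ (forall j, 0 <= u j) /\ \sum_(j < M) u j = 1 /\ p i = \sum_(j < M) u j *: q j.
  by move=> i; exact: Sp.
(* The types of [q] and [u] depend on [M i], so they are chosen after [M], as dependent families. *)
have {hM} /all_sig[q hq] : forall i, {q : 'I_(M i) -> 'rV[R]_d | exists u : 'I_(M i) -> R,
  (forall j, S (q j)) /\ (forall j, 0 <= u j) /\ \sum_(j < M i) u j = 1 /\ p i = \sum_(j < M i) u j *: q j}.
  by move=> i; apply: cid; exact: hM.
have {hq} /all_sig[u hu] : forall i, {u : 'I_(M i) -> R |
  (forall j, S (q i j)) /\ (forall j, 0 <= u j) /\ \sum_(j < M i) u j = 1 /\ p i = \sum_(j < M i) u j *: q i j}.
  by move=> i; apply: cid; exact: hq.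
have -> : \sum_(i < N) w i *: p i =
    \sum_(s : {i : 'I_N & 'I_(M i)}) (w (tag s) * u _ (tagged s)) *: q _ (tagged s).
  rewrite -(@sig_big_dep _ _ _ 'I_N (fun i => 'I_(M i)) xpredT (fun=> xpredT)
    (fun i j => (w i * u i j) *: q i j)) /=.
  apply: eq_bigr => i _; have [_ [_ [_ ->]]] := hu i.
  by rewrite scaler_sumr; apply: eq_bigr => j _; rewrite scalerA.
apply: conv_sum => [s|s|].
- by have [h _] := hu (tag s); exact: h.
- by have [_ [h _]] := hu (tag s); rewrite mulr_ge0.
rewrite -(@sig_big_dep _ _ _ 'I_N (fun i => 'I_(M i)) xpredT (fun=> xpredT)
    (fun i j => w i * u i j)) /= -[RHS]w1.
apply: eq_bigr => i _; have [_ [_ [h _]]] := hu i.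
by rewrite -mulr_sumr h mulr1.
Qed.

Lemma dotv_sum N a (p : 'I_N -> 'rV[R]_d) (w : 'I_N -> R) :
  dotv a (\sum_(i < N) w i *: p i) = \sum_(i < N) w i * dotv a (p i).
Proof.
rewrite /Defs.dotv.
under [RHS]eq_bigr do rewrite mulr_sumr.
rewrite exchange_big; apply: eq_bigr => j _ /=.
by rewrite summxE mulr_sumr; apply: eq_bigr => i _; rewrite mxE; ring.
Qed.

Lemma conv_dotv_le S a b x : (forall y, S y -> dotv a y <= b) -> conv S x -> dotv a x <= b.
Proof.
move=> Sb [N [p [w [Sp [w0 [w1 ->]]]]]]; rewrite dotv_sum.
have -> : b = \sum_(i < N) w i * b by rewrite -mulr_suml w1 mul1r.
by apply: ler_sum => i _; rewrite ler_wpM2l // Sb.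
Qed.

(** Equality in a weighted mean of values at most b forces every point of nonzero weight onto the
    hyperplane. *)
Lemma conv_dotv_eq S a b x : (forall y, S y -> dotv a y <= b) -> conv S x -> dotv a x = b ->
  conv (S `&` [set y | dotv a y = b]) x.
Proof.
move=> Sb [N [p [w [Sp [w0 [w1 ->]]]]]]; rewrite dotv_sum => wb.
have h i : w i = 0 \/ dotv a (p i) = b.
  have : \sum_(i < N) w i * (b - dotv a (p i)) = 0.
    under eq_bigr do rewrite mulrBr.
    by rewrite sumrB wb -mulr_suml w1 mul1r subrr.
  move/eqP; rewrite psumr_eq0; last by move=> j _; rewrite mulr_ge0 // subr_ge0 Sb.
  move=> /allP/(_ i); rewrite mem_index_enum => /(_ isT) /=.
  rewrite mulf_eq0 => /orP[/eqP|]; [by left|rewrite subr_eq0 eq_sym => /eqP; by right].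
have [i0 wi0] : exists i0, w i0 != 0.
  case: (pickP (fun i => w i != 0)) => [i0 wi0|wz]; first by exists i0.
  have := w1; rewrite big1 => [/eqP|i _]; first by rewrite eq_sym oner_eq0.
  by have /negbFE/eqP := wz i.
have [/eqP|pi0] := h i0; first by rewrite (negPf wi0).
(* Points off the hyperplane have weight zero and may be replaced by [p i0], which lies on it. *)
have -> : \sum_(i < N) w i *: p i =
    \sum_(i < N) w i *: (if dotv a (p i) == b then p i else p i0).
  apply: eq_bigr => i _; case: ifP => // /eqP ne.
  by have [->|] := h i; [rewrite !scale0r|].
by apply: conv_sum => // i; case: ifPn => [/eqP|].
Qed.

(** With the level normalised to 1, a point attaining it shows that a is nonzero. *)
Lemma is_face_conv S a : (forall y, S y -> dotv a y <= 1) -> (exists2 y, S y & dotv a y = 1) ->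
  is_face R d (conv S) (conv (S `&` [set y | dotv a y = 1])).
Proof.
move=> S1 [y Sy ay]; exists a, 1; split.
  apply/eqP => a0; move: ay; rewrite /Defs.dotv big1 => [/eqP|i _]; first by rewrite eq_sym oner_eq0.
  by rewrite a0 mxE mul0r.
split; first by move=> x; exact: conv_dotv_le.
split; first by exists y; split=> //; exact: sub_conv.
apply/seteqP; split=> x; last by move=> [cx ax]; exact: conv_dotv_eq.
move=> cx; split; first by apply: conv_subset cx => z [].
move: cx => [N [p [w [Sp [w0 [w1 ->]]]]]] /=; rewrite dotv_sum -[RHS]w1.
by apply: eq_bigr => i _; have [_ ->] := Sp i; rewrite mulr1.
Qed.

(** The hyperplane that isolates v must pass through a point of S by [conv_dotv_eq], and that point
    can only be v. *)
Lemma vertices_conv S v : vertices R d (conv S) v -> S v.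
Proof.
move=> [a [b [a0 [Sb [_ /seteqP[Fl Fr]]]]]].
have [cv vb] := Fl v erefl.
have Sb' y : S y -> dotv a y <= b by move=> Sy; apply: Sb; exact: sub_conv.
have [N [p [w [Sp [w0 [w1 _]]]]]] := conv_dotv_eq Sb' cv vb.
case: N p w Sp w0 w1 => [|N] p w Sp w0 w1.
  by move/eqP: w1; rewrite big_ord0 eq_sym oner_eq0.
have [Sp0 p0b] := Sp ord0.
by have <- : p ord0 = v by apply: Fr; split=> //; exact: sub_conv.
Qed.

Lemma conv1 v : conv [set v] = [set v].
Proof.
apply/seteqP; split=> x; last by move=> ->; exact: sub_conv.
move=> [N [p [w [Sp [w0 [w1 ->]]]]]] /=.
by under eq_bigr do rewrite Sp; rewrite -scaler_suml w1 scale1r.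
Qed.

End Convexity.

(** * The embedded copies and functionals given blockwise *)

Section Embedding.
Variable R : realType.

Lemma embed_sum D r c N (p : 'I_N -> 'rV[R]_D) (w : 'I_N -> R) :
  embed R D r c (\sum_(i < N) w i *: p i) = \sum_(i < N) w i *: embed R D r c (p i).
Proof.
apply/rowP => j; rewrite mxE summxE.
under [RHS]eq_bigr do rewrite !mxE.
case: (_ == c); last by rewrite big1 // => i _; rewrite mulr0.
case: eqP => [h|_]; last by rewrite big1 // => i _; rewrite mulr0.
by rewrite summxE; apply: eq_bigr => i _; rewrite mxE.
Qed.

Lemma embed_conv D r c (S : set 'rV[R]_D) :
  embed R D r c @` Defs.conv R D S `<=` Defs.conv R (D * r) (embed R D r c @` S).
Proof.
move=> _ [x [N [p [w [Sp [w0 [w1 ->]]]]]] <-]; rewrite embed_sum.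
by apply: conv_sum => // i; exists (p i).
Qed.

(** Cut the sum at cD and (c+1)D: the embedded point vanishes outside block c. *)
Lemma dotv_embed_Psi k m r c (A : nat -> nat -> R) (t : R) : (0 < k)%N -> (c < r)%N ->
  dotv R (6 * k * m.+1 * r)
    (\row_i A (i %/ (6 * k * m.+1))%N (i %% (6 * k * m.+1))%N)
    (embed R (6 * k * m.+1) r c (Psi R k m t)) =
  \sum_(0 <= j < 6 * k * m.+1) A c j * Psicoord R k t j.
Proof.
move=> k0 cr; have D0 : (0 < 6 * k * m.+1)%N by rewrite !muln_gt0 k0.
rewrite /dotv.
pose F i := A (i %/ (6 * k * m.+1))%N (i %% (6 * k * m.+1))%N *
  (if (i %/ (6 * k * m.+1) == c)%N then Psicoord R k t (i %% (6 * k * m.+1))%N else 0).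
transitivity (\sum_(i < 6 * k * m.+1 * r) F i).
  apply: eq_bigr => i _; rewrite !mxE /F; case: ifP => // _; congr (_ * _).
  by case: eqP => [h|]; [rewrite mxE|rewrite ltn_pmod].
move: (6 * k * m.+1)%N D0 @F => D D0 F.
rewrite -(big_mkord xpredT) (@big_cat_nat _ _ _ (c * D)) //=; last by rewrite mulnC leq_mul2l ltnW ?orbT.
rewrite (@big_cat_nat _ _ _ (c.+1 * D) (c * D)) //=; last 2 first.
- by rewrite leq_mul2r leqnSn orbT.
- by rewrite mulnC leq_mul2l cr orbT.
rewrite big_nat_cond big1 ?add0r; last first.
  move=> i /andP[/andP[_ ic] _]; rewrite /F; case: eqP => [e|]; last by rewrite mulr0.
  by move: ic; rewrite -ltn_divLR // e ltnn.
rewrite [X in _ + X]big_nat_cond [X in _ + X]big1 ?addr0; last first.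
  move=> i /andP[/andP[ic _] _]; rewrite /F; case: eqP => [e|]; last by rewrite mulr0.
  by move: ic; rewrite -leq_divRL // e ltnn.
rewrite -{1}[(c * D)%N]add0n big_addn mulSn addnK.
apply: eq_big_nat => i /andP[_ iD]; rewrite /F.
by rewrite addnC divnMDl // divn_small // addn0 eqxx modnMDl modn_small.
Qed.

End Embedding.

(** * Vertices and faces of Q *)

Section CrossPolytope.
Variables (R : realType) (k m n r : nat).
Hypotheses (k0 : (0 < k)%N) (m0 : (0 < m)%N) (n0 : (0 < n)%N).
Local Notation N := (n * 5 ^ m)%N.
Local Notation D := (6 * k * m.+1)%N.

Let N0 : (0 < N)%N.
Proof. by rewrite muln_gt0 n0 expn_gt0. Qed.

Definition angle (j : nat) : R := 2 * pi * j%:R / (n * 5 ^ m)%N%:R.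

Definition Qpoint (c j : nat) : 'rV[R]_(D * r) := embed R D r c (Psi R k m (angle j)).

Lemma angle_cos1_inj j j' : (j < N)%N -> (j' < N)%N -> cos (angle j - angle j') = 1 -> j = j'.
Proof.
move=> jN j'N /cos_eq1[z]; rewrite /angle => e.
have NR : (0 : R) < N%:R by rewrite ltr0n.
have pi0 : (0 : R) < pi by exact: pi_gt0.
have : (j%:Z - j'%:Z)%:~R = (z * N%:Z)%:~R :> R.
  have pne : pi != 0 :> R by rewrite gt_eqF.
  have Nne : N%:R != 0 :> R by rewrite gt_eqF.
  rewrite intrB intrM -!pmulrn.
  have aux (M p x y w : R) : M != 0 -> p != 0 ->
      2 * p * x / M - 2 * p * y / M = w * (p *+ 2) -> x - y = w * M.
    move=> M0 p0 h; have -> : x - y = (2 * p * x / M - 2 * p * y / M) * (M / (2 * p)).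
      by field; rewrite M0 p0.
    by rewrite h -mulr_natr; field.
  exact: aux Nne pne e.
move/intr_inj; move: (N) jN j'N => M jN j'N {}e.
have M0 : 0 < M%:Z by lia.
have z1 : z < 1 by rewrite -(ltr_pM2r M0) -e mul1r; lia.
have z2 : -1 < z by rewrite -(ltr_pM2r M0) -e mulN1r; lia.
have z0 : z = 0 by lia.
by move: e; rewrite z0 mul0r; lia.
Qed.

(** With M = n 5^l and rho = j mod M, the angle is congruent to 2 pi (digit/5 + rho/(5M)), so it
    differs from the midpoint of its arc by some y with |y| <= pi/5. As 2 pi/5 < pi/2, both cos y
    and cos 2y are positive, and the latter means sin(y)^2 < 1/2. *)
Lemma digit_arc l j : (l < m)%N ->
  0 < cos ((5 ^ (m - l.+1))%N%:R * angle j - 2 * pi * ((digit n l j)%:R / 5 + 10^-1)) /\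
  sin ((5 ^ (m - l.+1))%N%:R * angle j - 2 * pi * ((digit n l j)%:R / 5 + 10^-1)) ^+ 2 < 2^-1 :> R.
Proof.
move=> lm; rewrite /angle /digit.
have -> : N = (n * 5 ^ l * 5 * 5 ^ (m - l.+1))%N.
  by rewrite -!mulnA; congr (_ * _)%N; rewrite mulnA -expnSr -expnD subnKC.
set M := (n * 5 ^ l)%N; have M0 : (0 < M)%N by rewrite muln_gt0 n0 expn_gt0.
set p := (5 ^ _)%N; have p0 : (0 < p)%N by rewrite expn_gt0.
have jE : j = ((j %/ M %/ 5 * 5 + (j %/ M) %% 5) * M + j %% M)%N.
  by rewrite -divn_eq -divn_eq.
have rhoM : (j %% M < M)%N by rewrite ltn_mod.
set delta := (j %/ M %% 5)%N in jE *; set a := (j %/ M %/ 5)%N in jE.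
set rho := (j %% M)%N in jE rhoM *.
clearbody delta a rho p; clearbody M.
have MR : (0 : R) < M%:R by rewrite ltr0n.
have pi0 : (0 : R) < pi by exact: pi_gt0.
pose y : R := 2 * pi * (rho%:R / (5 * M%:R) - 10^-1).
have [-> ->] : cos (p%:R * (2 * pi * j%:R / (M * 5 * p)%N%:R) - 2 * pi * (delta%:R / 5 + 10^-1)) = cos y
   /\ sin (p%:R * (2 * pi * j%:R / (M * 5 * p)%N%:R) - 2 * pi * (delta%:R / 5 + 10^-1)) = sin y.
  apply: cos1B; apply: etrans (cos_mulz2pi R a%:Z); congr cos.
  have pne : p%:R != 0 :> R by rewrite pnatr_eq0 -lt0n.
  rewrite {1}jE /y -pmulrn !natrD !natrM natrD natrM; field.
  by rewrite pne gt_eqF.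

have rM : rho%:R / (5 * M%:R) < 5^-1 :> R.
  by rewrite invfM mulrCA gtr_pMr ?invr_gt0 // ltr_pdivrMr // mul1r ltr_nat.
have r0 : 0 <= rho%:R / (5 * M%:R) :> R by rewrite divr_ge0 // mulr_ge0 // ltW.
have ylo : - (pi / 5) <= y by rewrite /y; nra.
have yhi : y <= pi / 5 by rewrite /y; nra.
have cy : 0 < cos y by apply: cos_gt0_pihalf; apply/andP; split; lra.
have c2y : 0 < cos (y *+ 2).
  by apply: cos_gt0_pihalf; rewrite -mulr_natr; apply/andP; split; lra.
by split=> //; move: c2y; rewrite cos_mulr2n cos2sin2 -mulr_natr; lra.
Qed.

Lemma QpolyE : Qpoly R k m n r =
  Defs.conv R (D * r) [set v | exists c j, [/\ (c < r)%N, (j < N)%N & v = Qpoint c j]].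
Proof.
apply/seteqP; split.
  apply: subset_trans (@conv_idem _ _ _); apply: conv_subset => v [c /= cr].
  move=> /embed_conv; apply: conv_subset => _ [_ [t [j [jN ->]] <-] <-].
  by exists c, j.
apply: conv_subset => _ [c [j [cr jN ->]]]; exists c => //.
exists (Psi R k m (angle j)) => //; apply: sub_conv.
by exists (angle j) => //; exists j.
Qed.

Definition short_arc (T : seq nat) :=
  (size T <= k)%N /\ exists2 l, (l < m)%N & exists d, forall j, j \in T -> digit n l j = d.

Lemma Psi_cos1B t t' : cos (t - t') = 1 -> Psi R k m t = Psi R k m t'.
Proof.
move=> h; apply/rowP => i; rewrite !mxE; apply: Ucoord_cos1B.
by rewrite -mulrBr; exact: cos1_mulr_natl.
Qed.

Lemma short_arc_coefs (T : seq nat) : T = [::] \/ short_arc T ->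
  exists a : nat -> R, forall j, (j < N)%N ->
    \sum_(0 <= i < D) a i * Psicoord R k (angle j) i <= 1 /\
    (\sum_(0 <= i < D) a i * Psicoord R k (angle j) i = 1 <->
     exists2 b, b \in T & cos (angle j - angle b) = 1).
Proof.
case: (eqVneq T [::]) => [-> _|T0 [T0'|[Tk [l lm [d Td]]]]].
(* A copy without chosen points gets the zero functional, which never reaches 1. *)
- exists (fun=> 0) => j _; rewrite big1 => [|i _]; last by rewrite mul0r.
  split=> //; split=> [/eqP|[b]]; last by rewrite in_nil.
  by rewrite eq_sym oner_eq0.
- by rewrite T0' eqxx in T0.
have [||||h [a ha] hP] := @ex_exposing R k m [seq angle j | j <- iota 0 N] [seq angle j | j <- T]
    (m - l.+1) (2 * pi * (d%:R / 5 + 10^-1)).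
- by rewrite leq_subr.
- by rewrite -size_eq0 size_map size_eq0.
- by rewrite size_map.
- by move=> _ /mapP[j jT ->]; rewrite -(Td j jT); exact: digit_arc.
exists a => j jN; rewrite -ha.
have [|h1 hiff] := hP (angle j); first by rewrite map_f // mem_iota.
split=> //; rewrite hiff; split=> [[_ /mapP[b bT ->] hb]|[b bT hb]]; first by exists b.
by exists (angle b) => //; exact: map_f.
Qed.

(** The functionals of the copies share the bound 1, so their concatenation is at most 1 on Q and
    reaches 1 at exactly the chosen generators; one nonempty [T c] ensures that 1 is attained. *)
Lemma Qpoly_face (T : nat -> seq nat) :
  (forall c j, (c < r)%N -> j \in T c -> (j < N)%N) ->
  (forall c, (c < r)%N -> T c = [::] \/ short_arc (T c)) ->
  (exists2 c, (c < r)%N & T c <> [::]) ->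
  is_face R (D * r) (Qpoly R k m n r)
    (Defs.conv R (D * r) [set v | exists c j, [/\ (c < r)%N, j \in T c & v = Qpoint c j]]).
Proof.
move=> TN TP [c0 c0r T0].
have /choice[A hA] : forall c, exists a : nat -> R, (c < r)%N -> forall j, (j < N)%N ->
    \sum_(0 <= i < D) a i * Psicoord R k (angle j) i <= 1 /\
    (\sum_(0 <= i < D) a i * Psicoord R k (angle j) i = 1 <->
     exists2 b, b \in T c & cos (angle j - angle b) = 1).
  move=> c; case: (ltnP c r) => [cr|_]; last by exists (fun=> 0).
  by have [a ha] := short_arc_coefs (TP c cr); exists a.
rewrite QpolyE.
pose a : 'rV[R]_(D * r) := \row_i A (i %/ D)%N (i %% D)%N.
have aE c j : (c < r)%N -> dotv R (D * r) a (Qpoint c j) =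
    \sum_(0 <= i < D) A c i * Psicoord R k (angle j) i.
  by move=> cr; exact: dotv_embed_Psi.
set S := [set v | _].
have -> : [set v | exists c j, [/\ (c < r)%N, j \in T c & v = Qpoint c j]] =
    S `&` [set y | dotv R (D * r) a y = 1].
  apply/seteqP; split=> [_ [c [j [cr jT ->]]]|_ [[c [j [cr jN ->]]] /=]].
    have jN := TN c j cr jT; split; first by exists c, j.
    by rewrite /= aE //; apply/(proj2 (hA c cr j jN)); exists j; rewrite // subrr cos0.
  rewrite aE // => /(proj2 (hA c cr j jN))[b bT jb]; exists c, b; split=> //.
  by rewrite /Qpoint (Psi_cos1B jb).
apply: is_face_conv.
  by move=> _ [c [j [cr jN ->]]]; rewrite aE //; exact: (proj1 (hA c cr j jN)).
case E: (T c0) T0 => [//|j s] _; have jT : j \in T c0 by rewrite E mem_head.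
have jN := TN c0 j c0r jT; exists (Qpoint c0 j); first by exists c0, j.
by rewrite aE //; apply/(proj2 (hA c0 c0r j jN)); exists j; rewrite // subrr cos0.
Qed.

(** Each generator is a vertex by [Qpoly_face] for a single index in one copy; level 0 serves as the
    common digit. *)
Lemma vertices_Qpoly v : vertices R (D * r) (Qpoly R k m n r) v <->
  exists c j, [/\ (c < r)%N, (j < N)%N & v = Qpoint c j].
Proof.
split; first by rewrite QpolyE => /vertices_conv.
move=> [c [j [cr jN ->]]]; rewrite /vertices /=.
have := @Qpoly_face (fun c' => if c' == c then [:: j] else [::]).
have -> : [set v0 | exists c' j', [/\ (c' < r)%N, j' \in (if c' == c then [:: j] else [::])
    & v0 = Qpoint c' j']] = [set Qpoint c j].
  apply/seteqP; split=> [_ [c' [j' [_ + ->]]]|_ ->] /=.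
    by case: eqP => // ->; rewrite inE => /eqP ->.
  by exists c, j; rewrite eqxx mem_head.
rewrite conv1; apply.
- by move=> c' j' _; case: eqP => // _; rewrite inE => /eqP ->.
- move=> c' _; case: eqP => _; [right|by left]; split => //.
  by exists 0%N => //; exists (digit n 0 j) => j'; rewrite inE => /eqP ->.
- by exists c; rewrite ?eqxx.
Qed.

Lemma Qpoint_coord c c' j i : (c < r)%N -> (c' < r)%N -> (i < D)%N ->
  dotv R (D * r) (\row_s ((s %/ D == c') && (s %% D == i))%N%:R) (Qpoint c j) =
  if c == c' then Psicoord R k (angle j) i else 0.
Proof.
move=> cr c'r iD.
rewrite (dotv_embed_Psi m (fun q s => ((q == c') && (s == i))%:R) (angle j) k0 cr).
case: eqP => [_|_]; last by rewrite big1 // => s _; rewrite mul0r.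
rewrite (bigD1_seq i) ?mem_index_iota ?iota_uniq //= eqxx mul1r big1 ?addr0 //.
by move=> s /negPf ->; rewrite mul0r.
Qed.

(** The first two coordinates of block c are cos and sin of the angle. They determine j, and they
    cannot both vanish, as they would if the copies differed. *)
Lemma Qpoint_inj c c' j j' : (c < r)%N -> (c' < r)%N -> (j < N)%N -> (j' < N)%N ->
  Qpoint c j = Qpoint c' j' -> c = c' /\ j = j'.
Proof.
move=> cr c'r jN j'N e.
have D1 : (1 < D)%N by lia.
have h0 := Qpoint_coord j cr cr (ltnW D1); have h1 := Qpoint_coord j cr cr D1.
have g0 := Qpoint_coord j' c'r cr (ltnW D1); have g1 := Qpoint_coord j' c'r cr D1.
rewrite eqxx e g0 in h0; rewrite eqxx e g1 in h1.
have k6 : (1 < 6 * k)%N by lia.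
have P0 t : Psicoord R k t 0 = cos t.
  by rewrite /Psicoord div0n mod0n /Ucoord /= !mul1r.
have P1 t : Psicoord R k t 1 = sin t.
  by rewrite /Psicoord divn_small // modn_small // /Ucoord /= !mul1r.
rewrite !P0 in h0; rewrite !P1 in h1; move: h0 h1; case: eqP => [->|_] h0 h1.
  split=> //; apply: angle_cos1_inj => //.
  by rewrite cosB h0 h1 -!expr2 cos2Dsin2.
by have := cos2Dsin2 (angle j); rewrite -h0 -h1 expr0n addr0 => /eqP; rewrite eq_sym oner_eq0.
Qed.

End CrossPolytope.

(** * Counting the tuples of vertices that span a face *)

Section FaceCount.
Variables (R : realType) (k m n r : nat).
Hypotheses (k0 : (0 < k)%N) (m0 : (0 < m)%N) (n0 : (0 < n)%N).
Local Notation N := (n * 5 ^ m)%N.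
Local Notation D := (6 * k * m.+1)%N.
Local Notation Q := (Qpoly R k m n r).

Lemma spanning_pair_face (al : {ffun 'I_r -> 'I_r}) (be : {ffun 'I_r -> 'I_N}) : (0 < r)%N ->
  spanning_pair k al be ->
  is_face R (D * r) Q
    (Defs.conv R (D * r) [set Qpoint R k m n r (al i) (be i) | i in [set: 'I_r]]).
Proof.
move=> r0 /forallP sp.
(* Indices drawn in copy c, listed with repetition; the length is bounded by the size of the
   fiber. *)
pose T c := [seq (be i : nat) | i <- enum 'I_r & (al i == c :> nat)].
have TP c j : j \in T c -> exists2 i, al i = c :> nat & j = be i.
  by move=> /mapP[i + ->]; rewrite mem_filter => /andP[/eqP ? _]; exists i.
have inT i : (be i : nat) \in T (al i).
  by apply/mapP; exists i; rewrite // mem_filter eqxx mem_enum.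
have -> : [set Qpoint R k m n r (al i) (be i) | i in [set: 'I_r]] =
    [set v | exists c j, [/\ (c < r)%N, j \in T c & v = Qpoint R k m n r c j]].
  apply/seteqP; split=> [_ [i _ <-]|_ [c [j [cr /TP[i <- ->] ->]]]]; last by exists i.
  by exists (nat_of_ord (al i)), (nat_of_ord (be i)).
apply: Qpoly_face => //.
- by move=> c j cr /TP[i _ ->].
- move=> c cr; have /andP[ck /existsP[l /forall_inP hl]] := sp (Ordinal cr).
  case E: (T c) => [|j s]; [by left|right]; rewrite -E; split.
    rewrite size_map; apply: leq_trans ck; rewrite cardE.
    apply: uniq_leq_size => [|i]; first by rewrite filter_uniq // enum_uniq.
    by rewrite mem_filter !mem_enum !inE -val_eqE /= => /andP[].
  exists l => //; exists (digit n l j) => j' /TP[i' i'c ->].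
  have /TP[i ic ->] : j \in T c by rewrite E mem_head.
  have ifib : i \in fiber al (Ordinal cr) by rewrite inE -val_eqE /= ic.
  have i'fib : i' \in fiber al (Ordinal cr) by rewrite inE -val_eqE /= i'c.
  by have /forall_inP/(_ i ifib)/eqP := hl i' i'fib.
- exists (al (Ordinal r0)) => // e; have := inT (Ordinal r0); by rewrite e.
Qed.

Variable vs : seq 'rV[R]_(D * r).
Hypotheses (vs_uniq : uniq vs)
  (vsP : forall v, vertices R (D * r) Q v <-> v \in vs).

Let mem_vs (c : 'I_r) (j : 'I_N) : Qpoint R k m n r c j \in vs.
Proof. by apply/vsP/vertices_Qpoly => //; exists c, j. Qed.

Lemma size_vertices : size vs = (r * N)%N.
Proof.
pose pts := [seq Qpoint R k m n r (nat_of_ord p.1) (nat_of_ord p.2) | p <- enum {: 'I_r * 'I_N}].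
have upts : uniq pts.
  rewrite map_inj_uniq ?enum_uniq // => -[c j] [c' j'] /= /Qpoint_inj[] // e1 e2.
  by congr (_, _); exact: val_inj.
have /perm_size -> : perm_eq vs pts.
  apply: uniq_perm => // v; apply/idP/idP => [/vsP/vertices_Qpoly[]// c [j [cr jN ->]]|].
    by apply/mapP; exists (Ordinal cr, Ordinal jN); rewrite // mem_enum.
  by move=> /mapP[[c j] _ ->]; exact: mem_vs.
by rewrite size_map -cardE card_prod !card_ord.
Qed.

(** Replacing each drawn vertex by its position in [vs] maps spanning pairs injectively to tuples
    that span a face. *)
Lemma card_spanning_faces : (0 < r)%N ->
  (#|[set p : {ffun 'I_r -> 'I_r} * {ffun 'I_r -> 'I_N} | spanning_pair k p.1 p.2]%SET| <=
  #|[set f : {ffun 'I_r -> 'I_(size vs)} | `[< is_face R (D * r) Q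
       (Defs.conv R (D * r) [set nth 0%R vs (f i) | i in [set: 'I_r]]) >] ]|)%N.
Proof.
move=> r0.
have idx (c : 'I_r) (j : 'I_N) : (index (Qpoint R k m n r c j) vs < size vs)%N.
  by rewrite index_mem mem_vs.
pose phi (p : {ffun 'I_r -> 'I_r} * {ffun 'I_r -> 'I_N}) : {ffun 'I_r -> 'I_(size vs)} :=
  [ffun i => Ordinal (idx (p.1 i) (p.2 i))].
have phiE p i : nth 0 vs (phi p i) = Qpoint R k m n r (p.1 i) (p.2 i).
  by rewrite ffunE /= nth_index // mem_vs.
have phi_inj : injective phi.
  move=> [al be] [al' be'] e.
  have h i : Qpoint R k m n r (al i) (be i) = Qpoint R k m n r (al' i) (be' i).
    by rewrite -(phiE (al, be)) -(phiE (al', be')) e.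
  by congr (_, _); apply/ffunP => i; apply: val_inj; have /Qpoint_inj[] := h i.
rewrite -(card_imset _ phi_inj); apply: subset_leq_card; apply/fintype.subsetP => _ /imsetP[p + ->].
rewrite inE => sp; rewrite inE; apply/asboolP.
have -> : [set nth 0 vs (phi p i) | i in [set: 'I_r]] =
    [set Qpoint R k m n r (p.1 i) (p.2 i) | i in [set: 'I_r]].
  by apply: eq_imagel => i _; exact: phiE.
exact: spanning_pair_face.
Qed.

End FaceCount.

Unset Implicit Arguments.
Set Strict Implicit.

(** The hypothesis [hr2] is the second bound on r multiplied out; in this form it also covers k = 1,
    where the quotient has denominator zero. There are (r n 5^m)^r equally likely tuples, the total
    to which the count of spanning pairs refers. *)
Theorem theorem1p5 (R : realType) (k m n r : nat)
  (hk : (0 < k)%N) (hm : (0 < m)%N) (hn : (0 < n)%N) (hr : (0 < r)%N)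
  (hneven : ~~ odd n)
  (hr1 : (r < (k.+1)`!)%N)
  (hr2 : r%:R * (1 - ((5%:R : R) ^+ k.-1)^-1) ^+ m < 1)
  (vs : seq 'rV[R]_(6 * k * m.+1 * r))
  (hvs_uniq : uniq vs)
  (hvs : forall v, vertices R (6 * k * m.+1 * r) (Qpoly R k m n r) v <-> v \in vs) :
  (1 - r%:R / ((k.+1)`!)%:R) * (1 - r%:R * (1 - ((5%:R : R) ^+ k.-1)^-1) ^+ m)
    <= face_prob R (6 * k * m.+1 * r) (Qpoly R k m n r) vs r.
Proof.
have sN : (0 < r * (n * 5 ^ m))%N by rewrite !muln_gt0 hr hn expn_gt0.
have sz := size_vertices hk hm hn hvs_uniq hvs.
rewrite /face_prob ler_pdivlMr; last by rewrite sz ltr0n expn_gt0 sN.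
have -> : (size vs ^ r)%N%:R = r%:R ^+ r * (n * 5 ^ m)%N%:R ^+ r :> R.
  by rewrite sz natrX natrM exprMn.
apply: le_trans (card_spanning_pair hk hm hn hr hr2) _.
by rewrite ler_nat; exact: card_spanning_faces.
Qed.
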